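(* Let $C$ be a coalgebra over a field $K$. If $C$ is locally finite, then the Gabriel quiver of $C$ is locally finite (i.e., there are only finitely many arrows between arbitrary two vertices). Conversely, if the Gabriel quiver of $C$ is locally finite and the coradical $C_0$ of $C$ is separable, then $C$ is locally finite.
   Context: $K$ is a fixed field; all coalgebras and tensor products are over $K$. For subspaces $V,W$ of $C$, $V\wedge_CW=\{c\in C:\Delta_C(c)\in V\otimes C+C\otimes W\}$. A coalgebra $C$ is locally finite if $V\wedge_CW$ is finite-dimensional whenever $V$ and $W$ are finite-dimensional subspaces of $C$. A $K$-coalgebra $D$ is separable if $D\otimes L$ is a cosemisimple $L$-coalgebra for every field extension $L$ of $K$. Gabriel quiver: let $\{C_n\}$ be the coradical filtration of $C$, $C_0=\bigoplus_{i\in I}D^i$ with $D^i$ simple subcoalgebras, and $\pi_0:C\to C/C_0$ the projection. The maps $(\mathrm{Id}\otimes\pi_0)\circ\Delta_C$ and $(\pi_0\otimes \mathrm{Id})\circ\Delta_C$ vanish on $C_0$ and induce $\rho_l:C_1/C_0\to C_0\otimes C_1/C_0$ and $\rho_r:C_1/C_0\to C_1/C_0\otimes C_0$, making $C_1/C_0$ a $C_0$-$C_0$-bicomodule. Put ${}^i(C_1/C_0)^j=\{m\in C_1/C_0:\rho_l(m)\in D^i\otimes C_1/C_0,\ \rho_r(m)\in C_1/C_0\otimes D^j\}$, a $D^i$-$D^j$-bicomodule, hence a $(D^j)^*$-$(D^i)^*$-bimodule via $f\cdot m=\sum m_0f(m_1)$, $m\cdot g=\sum g(m_{-1})m_0$,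 where $\rho_r(m)=\sum m_0\otimes m_1$, $\rho_l(m)=\sum m_{-1}\otimes m_0$. Fix a primitive idempotent $e_i$ in the finite-dimensional simple algebra $(D^i)^*$. The Gabriel quiver $Q(C)$ has vertex set $I$ and $t_{ij}=\dim_K(e_i\cdot{}^j(C_1/C_0)^i\cdot e_j)$ arrows from $i$ to $j$ (independent of the choice of the $e_i$; $I$ and the $t_{ij}$ may be infinite). *)

(* Defs.v *)
From HB Require Import structures.
From mathcomp Require Import all_boot all_order all_algebra.
From mathcomp Require Import generic_quotient boolp classical_sets functions cardinality.
Set Implicit Arguments.
Unset Strict Implicit.
Unset Printing Implicit Defensive.
Import GRing.Theory.
Local Open Scope classical_set_scope.
Local Open Scope ring_scope.

Identity Coercion fun_of_set : set >-> Funclass.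

(** Sealed with [Qed], so that [/=] does not unfold the maps built with it; use [mklinE]. *)
Fact mklin_subproof (K : pzRingType) (V W : lmodType K) (f : V -> W)
  (hf : linear f) : {g : {linear V -> W} | g =1 f}.
Proof.
by exists (HB.pack_for {linear V -> W} f (GRing.isLinear.Build K V W *:%R f hf)).
Qed.
Definition mklin (K : pzRingType) (V W : lmodType K) (f : V -> W)
  (hf : linear f) : {linear V -> W} := sval (mklin_subproof hf).

Lemma mklinE (K : pzRingType) (V W : lmodType K) (f : V -> W) (hf : linear f) x :
  mklin hf x = f x.
Proof. exact: (svalP (mklin_subproof hf)). Qed.

Section Subspace.
Variables (K : fieldType) (V : lmodType K).

Record subspace := Subspace {
  ss_set :> set V ;
  ss_zero : ss_set 0 ;
  ss_lin : forall (a : K) u v, ss_set u -> ss_set v -> ss_set (a *: u + v) }.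

Implicit Types (U W : subspace) (A B : set V).

Lemma subspace_ext U W : (U : set V) = W -> U = W.
Proof.
case: U W => [U U0 UL] [W W0 WL] /= UW; subst W.
by congr Subspace; exact: Prop_irrelevance.
Qed.

Lemma ssD U u v : U u -> U v -> U (u + v).
Proof. by move=> hu hv; rewrite -[u]scale1r; apply: ss_lin. Qed.

Lemma ssZ U a u : U u -> U (a *: u).
Proof. by move=> hu; rewrite -[_ *: _]addr0; apply: ss_lin => //; apply: ss_zero. Qed.

Lemma ssN U u : U u -> U (- u).
Proof. by move=> hu; rewrite -scaleN1r; apply: ssZ. Qed.

Lemma ssB U u v : U u -> U v -> U (u - v).
Proof. by move=> hu hv; apply: ssD => //; apply: ssN. Qed.

Lemma ss_sum U (I : Type) (r : seq I) (P : pred I) (F : I -> V) :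
  (forall i, P i -> U (F i)) -> U (\sum_(i <- r | P i) F i).
Proof.
move=> h; elim/big_ind: _ => //; [exact: ss_zero | exact: ssD].
Qed.

Definition full_sp : subspace := @Subspace setT I (fun _ _ _ _ _ => I).

Fact span_zero A : [set x : V | forall U, A `<=` U -> U x] 0.
Proof. by move=> U _; apply: ss_zero. Qed.
Fact span_lin A (a : K) u v :
  [set x : V | forall U, A `<=` U -> U x] u ->
  [set x : V | forall U, A `<=` U -> U x] v ->
  [set x : V | forall U, A `<=` U -> U x] (a *: u + v).
Proof. by move=> hu hv U AU; apply: ss_lin; [apply: hu | apply: hv]. Qed.
Definition span A : subspace := Subspace (@span_zero A) (@span_lin A).

Lemma sub_span A : A `<=` span A.
Proof. by move=> x Ax U; apply. Qed.

Lemma span_min A U : A `<=` U -> span A `<=` U.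
Proof. by move=> AU x; apply. Qed.

Lemma span_sub A B : A `<=` B -> span A `<=` span B.
Proof. by move=> AB; apply: span_min => x /AB; apply: sub_span. Qed.

Definition fin_dim U := exists s : seq V, U = span [set` s].

Definition add_set A B := [set x : V | exists u v, [/\ A u, B v & x = u + v]].
Fact add_set_zero U W : add_set U W 0.
Proof. by exists 0, 0; rewrite addr0; split => //; apply: ss_zero. Qed.
Fact add_set_lin U W (a : K) x y :
  add_set U W x -> add_set U W y -> add_set U W (a *: x + y).
Proof.
move=> [u [v [hu hv ->]]] [u' [v' [hu' hv' ->]]].
exists (a *: u + u'), (a *: v + v'); split; try exact: ss_lin.
by rewrite scalerDr addrACA.
Qed.
Definition addsp U W : subspace := Subspace (@add_set_zero U W) (@add_set_lin U W).

Definition lin_indep B := forall (s : seq V) (a : V -> K),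
  uniq s -> [set` s] `<=` B -> \sum_(x <- s) a x *: x = 0 ->
  forall x, x \in s -> a x = 0.

Definition is_basis U B := lin_indep B /\ (span B : set V) = U.

Lemma chain_span (F : set (set V)) x :
  total_on F subset -> (exists X, F X) ->
  span (\bigcup_(X in F) X) x -> exists2 X, F X & span X x.
Proof.
move=> totF [X0 FX0].
pose S := [set x : V | exists2 X, F X & span X x].
have S0 : S 0 by exists X0 => //; apply: ss_zero.
have SL (a : K) u v : S u -> S v -> S (a *: u + v).
  move=> [X FX Xu] [Y FY Yv]; have [XY|YX] := totF _ _ FX FY.
    by exists Y => //; apply: ss_lin => //; apply: span_sub Xu.
  by exists X => //; apply: ss_lin => //; apply: span_sub Yv.
move=> /(_ (Subspace S0 SL)); apply => y [X FX Xy].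
by exists X => //; apply: sub_span.
Qed.

Lemma chain_seq (F : set (set V)) (s : seq V) :
  total_on F subset -> (exists X, F X) ->
  [set` s] `<=` \bigcup_(X in F) X -> exists2 X, F X & [set` s] `<=` X.
Proof.
move=> totF [X0 FX0]; elim: s => [|y s IH] hs; first by exists X0.
have [|X FX sX] := IH; first by move=> z zs; apply: hs; rewrite /= inE zs orbT.
have [Y FY Yy] : (\bigcup_(X in F) X) y by apply: hs; rewrite /= mem_head.
have [XY|YX] := totF _ _ FX FY.
  exists Y => // z /=; rewrite inE => /orP[/eqP -> //|zs]; exact/XY/sX.
exists X => // z /=; rewrite inE => /orP[/eqP ->|zs]; [exact: YX|exact: sX].
Qed.

Lemma basis_exists U : exists B, is_basis U B.
Proof.
pose P := [set B | lin_indep B /\ B `<=` U].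
have [F FP totF|B [[Bi BU] Bmax]] := @Zorn_bigcup V P.
  split; last by move=> x [X /FP[_ XU]]; apply: XU.
  have [F0|/forallNP F0] := pselect (exists X, F X).
    move=> s a us sF; have [X FX sX] := chain_seq totF F0 sF.
    by have [Xi _] := FP _ FX; apply: Xi.
  move=> s a us sF _ x xs; have [X FX _] := sF _ xs; by have := F0 _ FX.
exists B; split => //; apply/seteqP; split; first exact: span_min.
move=> u Uu; apply: contrapT => nBu.
apply: (Bmax (B `|` [set u])).
  split; first by move=> x; left.
  by move=> BB; apply: nBu; apply: sub_span; apply: BB; right.
split; last by move=> x [/BU//| ->].
move=> s a us sB; have [us'|us'] := boolP (u \in s); last first.
  move=> s0; apply: Bi => // x xs; have [//|xu] := sB x xs.
  by move: us'; rewrite -xu xs.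
have sB' : [set` rem u s] `<=` B.
  move=> x /=; rewrite mem_rem_uniq // inE => /andP[/eqP xu xs].
  by have [//|xu'] := sB _ xs.
rewrite (perm_big _ (perm_to_rem us')) big_cons /= => s0.
have au : a u = 0.
  apply/eqP; apply/negPn/negP => au; apply: nBu.
  have -> : u = (- (a u)^-1) *: \sum_(x <- rem u s) a x *: x.
    rewrite -[X in _ *: X](addKr (a u *: u)) s0 addr0.
    by rewrite scalerN scaleNr opprK scalerA mulVf // scale1r.
  apply: ssZ; rewrite big_seq; apply: ss_sum => x xs; apply: ssZ.
  by apply: sub_span; apply: sB'.
move: s0; rewrite au scale0r add0r => s0 x xs.
have [-> //|xu] := eqVneq x u.
by apply: (Bi (rem u s) a (rem_uniq _ us) sB' s0); rewrite mem_rem_uniq // inE xu.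
Qed.

Definition basis U : set V := proj1_sig (cid (basis_exists U)).

Lemma basisP U : is_basis U (basis U).
Proof. exact: (proj2_sig (cid (basis_exists U))). Qed.

Lemma complement_exists U :
  exists W : subspace, U `&` W `<=` [set 0] /\ (addsp U W : set V) = setT.
Proof.
pose P := [set B : set V | U `&` span B `<=` [set 0]].
have [F FP totF|B [PB Bmax]] := @Zorn_bigcup V P.
  have [F0|/forallNP F0] := pselect (exists X, F X).
    move=> x [Ux /(chain_span totF F0)[X FX Xx]]; exact: (FP _ FX).
  have L0 (a : K) (u v : V) : [set 0] u -> [set 0] v -> [set 0] (a *: u + v).
    by move=> -> ->; rewrite /= scaler0 addr0.
  move=> x [Ux] /(_ (@Subspace [set 0] (erefl _) L0)); apply => y [X FX _].
  by have := F0 _ FX.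
exists (span B); split => //; apply/seteqP; split => // v _.
apply: contrapT => nv; apply: (Bmax (B `|` [set v])).
  split; first by move=> x; left.
  move=> BB; apply: nv; exists 0, v; split; [exact: ss_zero| |by rewrite add0r].
  by apply: sub_span; apply: BB; right.
move=> x [Ux xB].
pose S := [set x : V | exists a w, span B w /\ x = a *: v + w].
have S0 : S 0 by exists 0, 0; rewrite scale0r addr0; split => //; apply: ss_zero.
have SL (a : K) y z : S y -> S z -> S (a *: y + z).
  move=> [b [w [hw ->]]] [c [w' [hw' ->]]].
  exists (a * b + c), (a *: w + w'); split; first exact: ss_lin.
  by rewrite scalerDr scalerA addrACA -scalerDl.
have [|a [w [hw xE]]] := xB (Subspace S0 SL).
  move=> y [By|->]; last by exists 1, 0; rewrite scale1r addr0; split => //; apply: ss_zero.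
  by exists 0, y; rewrite scale0r add0r; split => //; apply: sub_span.
have [a0|a0] := eqVneq a 0.
  by apply: PB; split => //; rewrite xE a0 scale0r add0r.
case: nv; exists (a^-1 *: x), (- (a^-1 *: w)); split.
- exact: ssZ.
- by apply: ssN; apply: ssZ.
- by rewrite xE scalerDr scalerA mulVf // scale1r addrK.
Qed.

End Subspace.
Arguments full_sp {K} V.

Section SubType.
Variables (K : fieldType) (V : lmodType K) (U : subspace V).

Definition ss_pred : {pred V} := fun x => `[< U x >].
Fact ss_pred_closed : subsemimod_closed ss_pred.
Proof.
do ![split] => /=.
- by apply/asboolP; apply: ss_zero.
- by move=> u v /asboolP hu /asboolP hv; apply/asboolP; apply: ssD.
- by move=> a u /asboolP hu; apply/asboolP; apply: ssZ.
Qed.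

Record subsp := Subsp { subsp_val :> V ; _ : subsp_val \in ss_pred }.
HB.instance Definition _ := [isSub for subsp_val].
HB.instance Definition _ := [Choice of subsp by <:].
HB.instance Definition _ :=
  GRing.SubChoice_isSubLmodule.Build K V ss_pred subsp ss_pred_closed.

Definition incl : {linear subsp -> V} := val.

Lemma inclP (x : subsp) : U (incl x).
Proof. by apply/asboolP; exact: (valP x). Qed.

Definition mksub (x : V) (hx : U x) : subsp := Subsp (asboolT hx).

Lemma incl_inj : injective incl. Proof. exact: val_inj. Qed.

Lemma retr_exists : exists r : {linear V -> subsp}, cancel incl r.
Proof.
have [W [UW UWT]] := complement_exists U.
have h (v : V) : exists u : subsp, W (v - incl u).
  have : addsp U W v by rewrite UWT.
  by move=> [u [w [hu hw ->]]]; exists (mksub hu); rewrite addrC addKr.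
pose r v := proj1_sig (cid (h v)).
have rP v : W (v - incl (r v)) by exact: (proj2_sig (cid (h v))).
have rU v u : W (v - incl u) -> r v = u.
  move=> hu; apply: incl_inj; apply/eqP; rewrite -subr_eq0; apply/eqP.
  apply: UW; split; first by rewrite -linearB; apply: inclP.
  have -> : incl (r v) - incl u = (v - incl u) - (v - incl (r v)).
    by rewrite opprB [RHS]addrC addrA subrK.
  exact: ssB.
have rL : linear r.
  move=> a u v; apply: rU; rewrite (linearP incl) opprD addrACA -scalerBr.
  exact: ss_lin.
exists (mklin rL) => x; rewrite mklinE; apply: rU; rewrite subrr; exact: ss_zero.
Qed.

Definition retr : {linear V -> subsp} := proj1_sig (cid retr_exists).
Lemma retrK : cancel incl retr. Proof. exact: (proj2_sig (cid retr_exists)). Qed.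
Lemma incl_retr x : U x -> incl (retr x) = x.
Proof. by move=> hx; rewrite -[x in LHS]/(incl (mksub hx)) retrK. Qed.

End SubType.

Section Quotient.
Variables (K : fieldType) (V : lmodType K) (U : subspace V).

Definition quot_rel : rel V := fun u v => `[< U (u - v) >].
Fact quot_rel_equiv : equiv_class_of quot_rel.
Proof.
split=> [u|u v|v u w].
- by apply/asboolP; rewrite subrr; apply: ss_zero.
- by apply/asboolP/asboolP => h; rewrite -opprB; apply: ssN.
- move=> /asboolP h /asboolP h'; apply/asboolP.
  by rewrite -[u](subrK v) -addrA; apply: ssD.
Qed.
Canonical quot_equiv := EquivRelPack quot_rel_equiv.

Definition quotsp := {eq_quot quot_equiv}%qT.
HB.instance Definition _ := Choice.on quotsp.

Definition quot_pi (v : V) : quotsp := (\pi_{eq_quot quot_equiv} v)%qT.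
Definition quot_repr (x : quotsp) : V := repr (x : {eq_quot quot_equiv}%qT).

Lemma quot_reprK x : quot_pi (quot_repr x) = x.
Proof. by rewrite /quot_pi /quot_repr reprK. Qed.

Lemma quot_eqP u v : quot_pi u = quot_pi v <-> U (u - v).
Proof.
by split=> [/eqquotP/asboolP//|h]; apply/eqquotP/asboolP.
Qed.

Lemma quot_repr_pi v : U (quot_repr (quot_pi v) - v).
Proof. by apply/quot_eqP; rewrite quot_reprK. Qed.

Let q0 : quotsp := quot_pi 0.
Let qopp x := quot_pi (- quot_repr x).
Let qadd x y := quot_pi (quot_repr x + quot_repr y).
Let qscale (a : K) x := quot_pi (a *: quot_repr x).

Let piN v : qopp (quot_pi v) = quot_pi (- v).
Proof. by apply/quot_eqP; rewrite -opprD; apply/ssN/quot_repr_pi. Qed.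
Let piD u v : qadd (quot_pi u) (quot_pi v) = quot_pi (u + v).
Proof. by apply/quot_eqP; rewrite opprD addrACA; apply: ssD; apply: quot_repr_pi. Qed.
Let piZ a v : qscale a (quot_pi v) = quot_pi (a *: v).
Proof. by apply/quot_eqP; rewrite -scalerBr; apply/ssZ/quot_repr_pi. Qed.

Let qW (P : quotsp -> Prop) : (forall v, P (quot_pi v)) -> forall x, P x.
Proof. by move=> h x; rewrite -(quot_reprK x). Qed.

Let qaddA : associative qadd.
Proof. by do 3!elim/qW => ?; rewrite !piD addrA. Qed.
Let qaddC : commutative qadd.
Proof. by do 2!elim/qW => ?; rewrite !piD addrC. Qed.
Let qadd0 : left_id q0 qadd.
Proof. by elim/qW => ?; rewrite piD add0r. Qed.
Let qaddN : left_inverse q0 qopp qadd.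
Proof. by elim/qW => ?; rewrite piN piD addNr. Qed.
HB.instance Definition _ := GRing.isZmodule.Build quotsp qaddA qaddC qadd0 qaddN.

Let qscaleA a b x : qscale a (qscale b x) = qscale (a * b) x.
Proof. by elim/qW: x => ?; rewrite !piZ scalerA. Qed.
Let qscale1 : left_id 1 qscale.
Proof. by elim/qW => ?; rewrite piZ scale1r. Qed.
Let qscaleDr : right_distributive qscale qadd.
Proof. by move=> a; do 2!elim/qW => ?; rewrite piD !piZ piD scalerDr. Qed.
Let qscaleDl x a b : qscale (a + b) x = qadd (qscale a x) (qscale b x).
Proof. by elim/qW: x => ?; rewrite !piZ piD scalerDl. Qed.
HB.instance Definition _ :=
  GRing.Zmodule_isLmodule.Build K quotsp qscaleA qscale1 qscaleDr qscaleDl.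

Fact quot_proj_linear : linear quot_pi.
Proof. by move=> a u v; rewrite -piD -piZ. Qed.
Definition quot_proj : {linear V -> quotsp} := mklin quot_proj_linear.

Lemma quot_projP (P : quotsp -> Prop) : (forall v, P (quot_proj v)) -> forall x, P x.
Proof. by move=> h; apply: qW => v; rewrite -(mklinE quot_proj_linear). Qed.

Lemma quot_proj_eq0 v : quot_proj v = 0 <-> U v.
Proof.
rewrite -[0](linear0 quot_proj) !mklinE.
by split=> [/quot_eqP|h]; [|apply/quot_eqP]; rewrite subr0.
Qed.

Section Lift.
Variables (W : lmodType K) (f : {linear V -> W}) (hf : forall u, U u -> f u = 0).

Fact quot_lift_pi v : f (quot_repr (quot_proj v)) = f v.
Proof.
by apply/eqP; rewrite mklinE -subr_eq0 -linearB hf //; apply: quot_repr_pi.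
Qed.
Fact quot_lift_linear : linear (f \o quot_repr).
Proof.
move=> a; do 2!elim/quot_projP => ?.
by rewrite -linearP /= !quot_lift_pi linearP.
Qed.
Definition quot_lift : {linear quotsp -> W} := mklin quot_lift_linear.
Lemma quot_liftE v : quot_lift (quot_proj v) = f v.
Proof. by rewrite mklinE; apply: quot_lift_pi. Qed.
End Lift.

End Quotient.

Definition bilin (K : fieldType) (V W M : lmodType K) (b : V -> W -> M) :=
  (forall w, linear (b^~ w)) /\ (forall v, linear (b v)).

Section Tensor.
Variables (K : fieldType) (V W : lmodType K).

(** A list of pairs stands for a formal sum of pure tensors. [teq] is the
    congruence generated by the relations of the tensor product; the universal
    property is [tens_lift], [tens_liftE], [tens_ext]. *)
Inductive teq : seq (V * W) -> seq (V * W) -> Prop :=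
| teq_refl s : teq s s
| teq_sym s t : teq s t -> teq t s
| teq_trans s t u : teq s t -> teq t u -> teq s u
| teq_perm s t : perm_eq s t -> teq s t
| teq_cat s t u : teq s t -> teq (s ++ u) (t ++ u)
| teq_0 : teq [:: (0, 0)] [::]
| teq_addl v v' w : teq [:: (v + v', w)] [:: (v, w); (v', w)]
| teq_addr v w w' : teq [:: (v, w + w')] [:: (v, w); (v, w')]
| teq_scale a v w : teq [:: (a *: v, w)] [:: (v, a *: w)].

Definition tens_rel : rel (seq (V * W)) := fun s t => `[< teq s t >].
Fact tens_rel_equiv : equiv_class_of tens_rel.
Proof.
split=> [s|s t|t s u].
- exact/asboolP/teq_refl.
- by apply/asboolP/asboolP; apply: teq_sym.
- by move=> /asboolP h /asboolP h'; apply/asboolP/(teq_trans h).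
Qed.
Canonical tens_equiv := EquivRelPack tens_rel_equiv.

Definition tens := {eq_quot tens_equiv}%qT.
HB.instance Definition _ := Choice.on tens.

Let tcl (s : seq (V * W)) : tens := (\pi_{eq_quot tens_equiv} s)%qT.
Let trepr (x : tens) : seq (V * W) := repr (x : {eq_quot tens_equiv}%qT).
Let treprK x : tcl (trepr x) = x.
Proof. by rewrite /tcl /trepr reprK. Qed.
Let tclP s t : tcl s = tcl t <-> teq s t.
Proof. by split=> [/eqquotP/asboolP//|h]; apply/eqquotP/asboolP. Qed.
Let trepr_tcl s : teq (trepr (tcl s)) s.
Proof. by apply/tclP; rewrite treprK. Qed.

Let teq_cat2 s s' t t' : teq s s' -> teq t t' -> teq (s ++ t) (s' ++ t').
Proof.
move=> hs ht; apply: teq_trans (teq_cat _ hs) _.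
apply: (teq_trans (teq_perm _)); first by rewrite perm_catC.
by apply: (teq_trans (teq_cat _ ht)); apply: teq_perm; rewrite perm_catC.
Qed.

Let sc (a : K) (s : seq (V * W)) := [seq (a *: p.1, p.2) | p <- s].
Let teq_sc a s t : teq s t -> teq (sc a s) (sc a t).
Proof.
elim=> {s t} /=.
- by move=> s; apply: teq_refl.
- by move=> s t _; apply: teq_sym.
- by move=> s t u _ h _; apply: teq_trans.
- by move=> s t h; apply: teq_perm; apply: perm_map.
- by move=> s t u _ h; rewrite /sc !map_cat; apply: teq_cat.
- by rewrite scaler0; apply: teq_0.
- by move=> v v' w; rewrite scalerDr; apply: teq_addl.
- by move=> v w w'; apply: teq_addr.
- move=> b v w; rewrite scalerA mulrC -scalerA; exact: teq_scale.
Qed.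

Let t0 : tens := tcl [::].
Let tadd x y := tcl (trepr x ++ trepr y).
Let tscale a x := tcl (sc a (trepr x)).
Let topp x := tscale (-1) x.

Let tclD s t : tadd (tcl s) (tcl t) = tcl (s ++ t).
Proof. by apply/tclP; apply: teq_cat2; apply: trepr_tcl. Qed.
Let tclZ a s : tscale a (tcl s) = tcl (sc a s).
Proof. by apply/tclP; apply: teq_sc; apply: trepr_tcl. Qed.
Let tW (P : tens -> Prop) : (forall s, P (tcl s)) -> forall x, P x.
Proof. by move=> h x; rewrite -(treprK x). Qed.

Let taddA : associative tadd.
Proof. by do 3!elim/tW => ?; rewrite !tclD catA. Qed.
Let taddC : commutative tadd.
Proof. by do 2!elim/tW => ?; rewrite !tclD; apply/tclP/teq_perm; rewrite perm_catC. Qed.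
Let tadd0 : left_id t0 tadd.
Proof. by elim/tW => ?; rewrite tclD. Qed.

Let tscaleA a b x : tscale a (tscale b x) = tscale (a * b) x.
Proof.
elim/tW: x => s; rewrite !tclZ /sc -map_comp; congr tcl.
by apply: eq_map => p /=; rewrite scalerA.
Qed.
Let tscale1 : left_id 1 tscale.
Proof.
elim/tW => s; rewrite !tclZ /sc; congr tcl; rewrite -[RHS]map_id.
by apply: eq_map => -[v w] /=; rewrite scale1r.
Qed.
Let tscaleDr : right_distributive tscale tadd.
Proof. by move=> a; do 2!elim/tW => ?; rewrite tclD !tclZ tclD /sc map_cat. Qed.
Let tscaleDl x a b : tscale (a + b) x = tadd (tscale a x) (tscale b x).
Proof.
elim/tW: x => s; rewrite !tclZ tclD; apply/tclP.
elim: s => [|[v w] s IH] /=; first exact: teq_refl.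
rewrite scalerDl -cat1s; apply: teq_trans (teq_cat2 (teq_addl _ _ _) IH) _.
apply: teq_perm; rewrite /= perm_cons -cat1s -[in X in perm_eq _ X]cat1s !catA.
by rewrite perm_cat2r perm_catC.
Qed.
Let tscale0 x : tscale 0 x = t0.
Proof.
elim/tW: x => s; rewrite tclZ; apply/tclP.
elim: s => [|[v w] s IH] /=; first exact: teq_refl.
rewrite -cat1s -[[::]]cats0; apply: teq_cat2 IH.
rewrite scale0r.
apply: teq_trans teq_0; have := teq_scale 0 (0 : V) w.
by rewrite !scale0r.
Qed.
Let taddN : left_inverse t0 topp tadd.
Proof.
by move=> x; rewrite /topp -[X in tadd _ X]tscale1 -tscaleDl addNr tscale0.
Qed.
HB.instance Definition _ := GRing.isZmodule.Build tens taddA taddC tadd0 taddN.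
HB.instance Definition _ :=
  GRing.Zmodule_isLmodule.Build K tens tscaleA tscale1 tscaleDr tscaleDl.

Definition pure (v : V) (w : W) : tens := tcl [:: (v, w)].

Lemma pure_bilin : bilin pure.
Proof.
split=> [w a u v|v a u w].
  transitivity (pure (a *: u) w + pure v w).
    by rewrite [RHS]tclD; apply/tclP; apply: teq_addl.
  by congr (_ + _); rewrite [RHS]tclZ.
transitivity (pure v (a *: u) + pure v w).
  by rewrite [RHS]tclD; apply/tclP; apply: teq_addr.
congr (_ + _); rewrite [RHS]tclZ; apply/tclP; apply: teq_sym; exact: teq_scale.
Qed.

Lemma tens_ind (P : tens -> Prop) :
  P 0 -> (forall x y, P x -> P y -> P (x + y)) -> (forall v w, P (pure v w)) ->
  forall x, P x.
Proof.
move=> P0 PD Pp; elim/tW; elim=> [|[v w] s IH]; first exact: P0.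
have -> : tcl ((v, w) :: s) = pure v w + tcl s by rewrite [RHS]tclD.
by apply: PD.
Qed.

Section Lift.
Variables (M : lmodType K) (b : V -> W -> M) (hb : bilin b).

Let ev (s : seq (V * W)) : M := \sum_(p <- s) b p.1 p.2.
Let bDl v v' w : b (v + v') w = b v w + b v' w.
Proof. by have := hb.1 w 1 v v'; rewrite !scale1r. Qed.
Let bDr v w w' : b v (w + w') = b v w + b v w'.
Proof. by have := hb.2 v 1 w w'; rewrite !scale1r. Qed.
Let b0l w : b 0 w = 0.
Proof. by apply: (addrI (b 0 w)); rewrite -bDl !addr0. Qed.
Let b0r v : b v 0 = 0.
Proof. by apply: (addrI (b v 0)); rewrite -bDr !addr0. Qed.
Let bZl a v w : b (a *: v) w = a *: b v w.
Proof. by have := hb.1 w a v 0; rewrite !addr0 b0l addr0. Qed.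
Let bZr a v w : b v (a *: w) = a *: b v w.
Proof. by have := hb.2 v a w 0; rewrite !addr0 b0r addr0. Qed.

Let ev_teq s t : teq s t -> ev s = ev t.
Proof.
rewrite /ev; elim=> {s t}.
- by [].
- by move=> s t _ ->.
- by move=> s t u _ -> _ ->.
- by move=> s t h; apply: perm_big.
- by move=> s t u _ h; rewrite !big_cat /= h.
- by rewrite big_seq1 big_nil /= b0l.
- by move=> v v' w; rewrite !big_cons big_nil /= !addr0 bDl.
- by move=> v w w'; rewrite !big_cons big_nil /= !addr0 bDr.
- by move=> a v w; rewrite !big_seq1 /= bZl bZr.
Qed.

Let ev_tcl s : ev (trepr (tcl s)) = ev s.
Proof. exact: ev_teq. Qed.

Fact tens_lift_linear : linear (fun x : tens => ev (trepr x)).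
Proof.
move=> a; elim/tW => s; elim/tW => s0.
have -> : a *: tcl s + tcl s0 = tcl (sc a s ++ s0).
  by rewrite -tclD -tclZ.
rewrite !ev_tcl /ev big_cat /=; congr (_ + _).
rewrite /sc big_map scaler_sumr; apply: eq_bigr => p _ /=; exact: bZl.
Qed.
Definition tens_lift : {linear tens -> M} := mklin tens_lift_linear.

Lemma tens_liftE v w : tens_lift (pure v w) = b v w.
Proof. by rewrite [LHS]mklinE [LHS]ev_tcl /ev big_seq1. Qed.

End Lift.

Lemma tens_ext (M : lmodType K) (f g : {linear tens -> M}) :
  (forall v w, f (pure v w) = g (pure v w)) -> f =1 g.
Proof.
move=> h; elim/tens_ind => //; first by rewrite !linear0.
by move=> x y hx hy; rewrite !linearD hx hy.
Qed.

End Tensor.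

Notation "V \otimes W" := (tens V W) (at level 40, left associativity) : type_scope.
Notation "v \ot w" := (pure v w) (at level 40, left associativity) : ring_scope.

Section TensorMaps.
Variable K : fieldType.
Implicit Types U V W M : lmodType K.

Lemma pureDl V W (v v' : V) (w : W) : (v + v') \ot w = v \ot w + v' \ot w.
Proof. by have := (pure_bilin V W).1 w 1 v v'; rewrite !scale1r. Qed.
Lemma pureDr V W (v : V) (w w' : W) : v \ot (w + w') = v \ot w + v \ot w'.
Proof. by have := (pure_bilin V W).2 v 1 w w'; rewrite !scale1r. Qed.
Lemma pure0l V W (w : W) : (0 : V) \ot w = 0.
Proof. by apply: (addrI ((0 : V) \ot w)); rewrite -pureDl !addr0. Qed.
Lemma pure0r V W (v : V) : v \ot (0 : W) = 0.
Proof. by apply: (addrI (v \ot (0 : W))); rewrite -pureDr !addr0. Qed.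
Lemma pureZl V W a (v : V) (w : W) : (a *: v) \ot w = a *: (v \ot w).
Proof. by have := (pure_bilin V W).1 w a v 0; rewrite pure0l !addr0. Qed.
Lemma pureZr V W a (v : V) (w : W) : v \ot (a *: w) = a *: (v \ot w).
Proof. by have := (pure_bilin V W).2 v a w 0; rewrite pure0r !addr0. Qed.

Fact tens_map_bilin V W V' W' (f : {linear V -> V'}) (g : {linear W -> W'}) :
  bilin (fun v w => f v \ot g w).
Proof.
by split=> [w a u v|v a u w]; rewrite linearP ?pureDl ?pureZl ?pureDr ?pureZr.
Qed.
Definition tens_map V W V' W' (f : {linear V -> V'}) (g : {linear W -> W'}) :
  {linear V \otimes W -> V' \otimes W'} := tens_lift (tens_map_bilin f g).

Lemma tens_mapE V W V' W' (f : {linear V -> V'}) (g : {linear W -> W'}) v w :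
  tens_map f g (v \ot w) = f v \ot g w.
Proof. exact: tens_liftE. Qed.

Lemma tens_map_eq V W V' W' (f f' : {linear V -> V'}) (g g' : {linear W -> W'}) :
  f =1 f' -> g =1 g' -> tens_map f g =1 tens_map f' g'.
Proof. by move=> ff gg; apply: tens_ext => v w; rewrite !tens_mapE ff gg. Qed.

Lemma tens_map_comp V W V' W' V'' W'' (f : {linear V -> V'}) (g : {linear W -> W'})
    (f' : {linear V' -> V''}) (g' : {linear W' -> W''}) x :
  tens_map f' g' (tens_map f g x) = tens_map (f' \o f) (g' \o g) x.
Proof.
apply: (tens_ext (f := tens_map f' g' \o tens_map f g)) => v w.
by rewrite [LHS](congr1 (tens_map f' g') (tens_mapE f g v w)) !tens_mapE.
Qed.

Lemma tens_map_id V W (f : {linear V -> V}) (g : {linear W -> W}) :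
  f =1 id -> g =1 id -> tens_map f g =1 id.
Proof.
move=> ff gg; apply: (tens_ext (g := idfun)) => v w.
by rewrite tens_mapE ff gg.
Qed.

Fact pure_left_linear V W (w : W) : linear (fun v : V => v \ot w).
Proof. exact: (pure_bilin V W).1. Qed.
Definition pure_left V W (w : W) : {linear V -> V \otimes W} :=
  mklin (pure_left_linear w).

Fact tens_assoc_bilin U V W :
  bilin (fun (x : U \otimes V) (w : W) => tens_map idfun (pure_left V w) x).
Proof.
split=> [w a x y|x a u v]; first by rewrite linearP.
elim/tens_ind: x => [|x y hx hy|p q]; first by rewrite !linear0 addr0.
  by rewrite !linearD hx hy addrACA.
by rewrite !tens_mapE !mklinE /= !pureDr !pureZr.
Qed.
Definition tens_assoc U V W :
    {linear (U \otimes V) \otimes W -> U \otimes (V \otimes W)} :=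
  tens_lift (@tens_assoc_bilin U V W).

Lemma tens_assocE U V W (u : U) (v : V) (w : W) :
  tens_assoc U V W ((u \ot v) \ot w) = u \ot (v \ot w).
Proof. by rewrite tens_liftE tens_mapE mklinE. Qed.

Lemma tens_assoc_nat U V W U' V' W' (f : {linear U -> U'}) (g : {linear V -> V'})
    (h : {linear W -> W'}) x :
  tens_map f (tens_map g h) (tens_assoc U V W x) =
  tens_assoc U' V' W' (tens_map (tens_map f g) h x).
Proof.
elim/tens_ind: x => [|x y hx hy|x w]; first by rewrite !linear0.
  by rewrite !linearD hx hy.
elim/tens_ind: x => [|x y hx hy|u v]; first by rewrite pure0l !linear0.
  by rewrite pureDl !linearD hx hy.
by rewrite !(tens_mapE, tens_assocE).
Qed.

Fact tens_lunit_bilin V : bilin (fun (a : K^o) (v : V) => (a : K) *: v).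
Proof.
split=> [v a x y|x a u v]; last by rewrite scalerDr !scalerA mulrC.
by rewrite scalerDl -scalerA.
Qed.
Definition tens_lunit V : {linear (K^o : lmodType K) \otimes V -> V} :=
  tens_lift (@tens_lunit_bilin V).

Fact tens_runit_bilin V : bilin (fun (v : V) (a : K^o) => (a : K) *: v).
Proof. by have [h h'] := tens_lunit_bilin V; split. Qed.
Definition tens_runit V : {linear V \otimes (K^o : lmodType K) -> V} :=
  tens_lift (@tens_runit_bilin V).

Lemma tens_lunitE V (a : K) (v : V) : tens_lunit V ((a : K^o) \ot v) = a *: v.
Proof. exact: tens_liftE. Qed.
Lemma tens_runitE V (a : K) (v : V) : tens_runit V (v \ot (a : K^o)) = a *: v.
Proof. exact: tens_liftE. Qed.

(** The image of [A \otimes B] in [V \otimes W]. *)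
Definition tens_sub V W (A : subspace V) (B : subspace W) : subspace (V \otimes W) :=
  span [set x | exists v w, [/\ A v, B w & x = v \ot w]].

Lemma tens_sub_pure V W (A : subspace V) (B : subspace W) v w :
  A v -> B w -> tens_sub A B (v \ot w).
Proof. by move=> hv hw; apply: sub_span; exists v, w. Qed.

Lemma tens_subS V W (A A' : subspace V) (B B' : subspace W) :
  A `<=` A' -> B `<=` B' -> tens_sub A B `<=` tens_sub A' B'.
Proof.
move=> AA BB; apply: span_min => _ [v [w [hv hw ->]]].
by apply: tens_sub_pure; [apply: AA | apply: BB].
Qed.

Fact preimsp_zero V W (f : {linear V -> W}) (B : subspace W) : (f @^-1` B) 0.
Proof. by rewrite /preimage /= linear0; apply: ss_zero. Qed.
Fact preimsp_lin V W (f : {linear V -> W}) (B : subspace W) (a : K) u v :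
  (f @^-1` B) u -> (f @^-1` B) v -> (f @^-1` B) (a *: u + v).
Proof. by rewrite /preimage /= linearP; apply: ss_lin. Qed.
Definition preimsp V W (f : {linear V -> W}) (B : subspace W) : subspace V :=
  Subspace (@preimsp_zero _ _ f B) (@preimsp_lin _ _ f B).

Fact imsp_zero V W (f : {linear V -> W}) (A : subspace V) : (f @` A) 0.
Proof. by exists 0; [apply: ss_zero | rewrite linear0]. Qed.
Fact imsp_lin V W (f : {linear V -> W}) (A : subspace V) (a : K) u v :
  (f @` A) u -> (f @` A) v -> (f @` A) (a *: u + v).
Proof.
by move=> [x hx <-] [y hy <-]; exists (a *: x + y); [apply: ss_lin | rewrite linearP].
Qed.
Definition imsp V W (f : {linear V -> W}) (A : subspace V) : subspace W :=
  Subspace (@imsp_zero _ _ f A) (@imsp_lin _ _ f A).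

Lemma span_eq_ext V W (f g : {linear V -> W}) (A : set V) :
  (forall x, A x -> f x = g x) -> forall x, span A x -> f x = g x.
Proof.
move=> h x; pose S := preimsp (f \- g) (@Subspace _ W [set 0] (erefl _)
  (fun a u v (hu : u = 0) (hv : v = 0) =>
     etrans (congr2 (fun u v => a *: u + v) hu hv)
            (etrans (addr0 _) (scaler0 _ a)))).
move=> /(_ S) hS; apply/eqP; rewrite -subr_eq0; apply/eqP; apply: hS => y Ay.
by rewrite /= /preimage /= h // subrr.
Qed.

End TensorMaps.

HB.mixin Record isCoalgebra (K : fieldType) C of GRing.Lmodule K C := {
  comul : {linear C -> C \otimes C} ;
  counit : {linear C -> K^o} ;
  comulA : forall c,
    tens_assoc C C C (tens_map comul idfun (comul c)) =
    tens_map idfun comul (comul c) ;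
  counitl : forall c, tens_lunit C (tens_map counit idfun (comul c)) = c ;
  counitr : forall c, tens_runit C (tens_map idfun counit (comul c)) = c }.

#[short(type="coalgType")]
HB.structure Definition Coalgebra (K : fieldType) :=
  {C of isCoalgebra K C & GRing.Lmodule K C}.

Section CoalgebraTheory.
Variables (K : fieldType) (C : coalgType K).

Definition wedge (V W : subspace C) : subspace C :=
  preimsp comul (addsp (tens_sub V (full_sp C)) (tens_sub (full_sp C) W)).

Definition locally_finite :=
  forall V W : subspace C, fin_dim V -> fin_dim W -> fin_dim (wedge V W).

Record subcoalg := Subcoalg {
  subcoalg_sp :> subspace C ;
  subcoalgP : forall c, subcoalg_sp c -> tens_sub subcoalg_sp subcoalg_sp (comul c) }.

Definition simple_subcoalg (D : subcoalg) :=
  (exists2 d : C, D d & d <> 0) /\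
  (forall E : subcoalg, (E : set C) `<=` D ->
     (E : set C) = [set 0] \/ (E : set C) = D).

Definition coradical_sp : subspace C :=
  span (\bigcup_(D in [set D : subcoalg | simple_subcoalg D]) (D : set C)).

Lemma simple_sub_coradical (D : subcoalg) :
  simple_subcoalg D -> (D : set C) `<=` coradical_sp.
Proof. by move=> hD x Dx; apply: sub_span; exists D. Qed.

Fact coradicalP c : coradical_sp c -> tens_sub coradical_sp coradical_sp (comul c).
Proof.
move=> hc; apply: (hc (preimsp comul (tens_sub coradical_sp coradical_sp))).
move=> x [D hD Dx]; change (tens_sub coradical_sp coradical_sp (comul x)).
exact: (tens_subS (simple_sub_coradical hD) (simple_sub_coradical hD) (subcoalgP Dx)).
Qed.
Definition coradical : subcoalg := Subcoalg coradicalP.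

Definition cosemisimple := (coradical : set C) = setT.

Fixpoint coradical_filtration (n : nat) : subspace C :=
  if n is n'.+1 then wedge coradical (coradical_filtration n') else coradical.

(** The dual algebra, with the convolution product
    [(f * g) c = \sum f c_1 * g c_2]. *)
Definition dual := {linear C -> K^o}.

Definition conv (f g : dual) : dual :=
  tens_lunit K^o \o tens_map f g \o comul.

Definition idempotent (f : dual) := conv f f =1 f.

Definition primitive_idempotent (e : dual) :=
  [/\ idempotent e, ~ (e =1 \0) &
      forall f g : dual, idempotent f -> idempotent g ->
        conv f g =1 \0 -> conv g f =1 \0 -> e =1 f \+ g ->
        f =1 \0 \/ g =1 \0].

End CoalgebraTheory.
Arguments coradical {K} C.
Arguments coradical_filtration {K} C n.
Arguments cosemisimple {K} C.
Arguments locally_finite {K} C.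

Section Subcoalgebra.
Variables (K : fieldType) (C : coalgType K) (D : subcoalg C).

Definition subcoalg_type := subsp D.
HB.instance Definition _ := GRing.Lmodule.on subcoalg_type.

Local Notation i := (incl D : {linear subcoalg_type -> C}).
Local Notation r := (retr D : {linear C -> subcoalg_type}).

(** The corestriction of [comul] to [D \otimes D], see [sub_comulE]. *)
Definition sub_comul : {linear subcoalg_type -> subcoalg_type \otimes subcoalg_type} :=
  tens_map r r \o comul \o i.
Definition sub_counit : {linear subcoalg_type -> K^o} := counit \o i.

Lemma sub_comulE d : tens_map i i (sub_comul d) = comul (i d).
Proof.
rewrite tens_map_comp.
apply: (@span_eq_ext _ _ _ _ idfun) (subcoalgP (inclP d)).
by move=> _ [v [w [hv hw ->]]]; rewrite tens_mapE; congr (_ \ot _); apply: incl_retr.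
Qed.

Let comulA_sub c :
  tens_assoc _ _ _ (tens_map sub_comul idfun (sub_comul c)) =
  tens_map idfun sub_comul (sub_comul c).
Proof.
apply: (can_inj (g := tens_map r (tens_map r r)) (f := tens_map i (tens_map i i))).
  move=> x; rewrite tens_map_comp; apply: tens_map_id; first exact: retrK.
  have h := tens_map_id (f := r \o i) (g := r \o i) (@retrK _ _ D) (@retrK _ _ D).
  by move=> y; rewrite -[RHS]h -tens_map_comp.
have h1 x : tens_map (tens_map i i) i (tens_map sub_comul idfun x) =
            tens_map comul idfun (tens_map i i x).
  by rewrite !tens_map_comp; apply: tens_map_eq => // y; apply: sub_comulE.
have h2 x : tens_map i (tens_map i i) (tens_map idfun sub_comul x) =
            tens_map idfun comul (tens_map i i x).
  by rewrite !tens_map_comp; apply: tens_map_eq => // y; apply: sub_comulE.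
by rewrite tens_assoc_nat h1 h2 sub_comulE comulA.
Qed.

Let counitl_sub c : tens_lunit _ (tens_map sub_counit idfun (sub_comul c)) = c.
Proof.
have h x : i (tens_lunit _ (tens_map sub_counit idfun x)) =
           tens_lunit _ (tens_map counit idfun (tens_map i i x)).
  elim/tens_ind: x => [|x y hx hy|x y]; first by rewrite !linear0.
    by rewrite !linearD hx hy.
  by rewrite !tens_mapE !tens_lunitE linearZ.
by apply: (@incl_inj _ _ D); rewrite [LHS]h sub_comulE counitl.
Qed.

Let counitr_sub c : tens_runit _ (tens_map idfun sub_counit (sub_comul c)) = c.
Proof.
have h x : i (tens_runit _ (tens_map idfun sub_counit x)) =
           tens_runit _ (tens_map idfun counit (tens_map i i x)).
  elim/tens_ind: x => [|x y hx hy|x y]; first by rewrite !linear0.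
    by rewrite !linearD hx hy.
  by rewrite !tens_mapE !tens_runitE linearZ.
by apply: (@incl_inj _ _ D); rewrite [LHS]h sub_comulE counitr.
Qed.

HB.instance Definition _ :=
  isCoalgebra.Build K subcoalg_type comulA_sub counitl_sub counitr_sub.

End Subcoalgebra.

Section Restriction.
Variables (K L : fieldType) (iota : {rmorphism K -> L}).

Definition restr (M : lmodType L) : Type := M.

Section RestrInstance.
Variable M : lmodType L.
HB.instance Definition _ := GRing.Zmodule.copy (restr M) M.
Let rscale (a : K) (m : restr M) : restr M := iota a *: (m : M).
Let rscaleA a b m : rscale a (rscale b m) = rscale (a * b) m.
Proof. by rewrite /rscale scalerA rmorphM. Qed.
Let rscale1 : left_id 1 rscale.
Proof. by move=> m; rewrite /rscale rmorph1 scale1r. Qed.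
Let rscaleDr : right_distributive rscale +%R.
Proof. by move=> a m m'; rewrite /rscale scalerDr. Qed.
Let rscaleDl m : {morph rscale^~ m : a b / a + b}.
Proof. by move=> a b; rewrite /rscale rmorphD scalerDl. Qed.
HB.instance Definition _ :=
  GRing.Zmodule_isLmodule.Build K (restr M) rscaleA rscale1 rscaleDr rscaleDl.
Lemma restrZ (a : K) (m : restr M) : a *: m = (iota a *: (m : M)) :> M.
Proof. by []. Qed.
End RestrInstance.

Local Notation Lk := (restr L^o).

Fact mulL_linear (a : L) : linear ((fun l : L => a * l) : Lk -> Lk).
Proof.
move=> b u v; change (a * (iota b * u + v) = iota b * (a * u) + a * v :> L).
by rewrite mulrDr mulrCA.
Qed.
Definition mulL (a : L) : {linear Lk -> Lk} := mklin (@mulL_linear a).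

Section BaseExt.
Variable V : lmodType K.

(** [V \otimes_K L] with [L] acting on the second factor. *)
Definition base_ext : Type := V \otimes Lk.
HB.instance Definition _ := GRing.Zmodule.copy base_ext (V \otimes Lk).

Let escale (a : L) (x : base_ext) : base_ext :=
  tens_map idfun (mulL a) (x : V \otimes Lk).
Let escaleA a b x : escale a (escale b x) = escale (a * b) x.
Proof.
rewrite /escale tens_map_comp; apply: tens_map_eq => // l /=.
rewrite !mklinE; exact: (mulrA a b (l : L)).
Qed.
Let escale1 : left_id 1 escale.
Proof.
by move=> x; apply: tens_map_id => // l; rewrite mklinE; apply: (mul1r (l : L)).
Qed.
Let escaleDr : right_distributive escale +%R.
Proof. by move=> a x y; rewrite /escale [LHS]linearD. Qed.
Let escaleDl x : {morph escale^~ x : a b / a + b}.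
Proof.
move=> a b; rewrite /escale; elim/tens_ind: x => [|x y hx hy|v l].
- by rewrite !linear0 [RHS]addr0.
- rewrite linearD [X in X + _]hx [X in _ + X]hy !linearD; exact: addrACA.
- rewrite !tens_mapE !mklinE -[RHS]pureDr; congr (_ \ot _); exact: (mulrDl a b (l : L)).
Qed.
HB.instance Definition _ :=
  GRing.Zmodule_isLmodule.Build L base_ext escaleA escale1 escaleDr escaleDl.

Definition base_in (v : V) : base_ext := v \ot ((1 : L) : Lk).

Lemma base_extE (v : V) (l : L) : v \ot (l : Lk) = l *: base_in v :> base_ext.
Proof.
rewrite [RHS]tens_mapE mklinE; congr (_ \ot _); symmetry; exact: (mulr1 l).
Qed.

Lemma base_ext_ind (P : base_ext -> Prop) :
  P 0 -> (forall x y, P x -> P y -> P (x + y)) ->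
  (forall v l, P (l *: base_in v)) -> forall x, P x.
Proof.
by move=> P0 PD PZ; elim/tens_ind => // v l; rewrite [_ \ot _]base_extE.
Qed.

Fact base_in_linear : linear (base_in : V -> restr base_ext).
Proof.
move=> a u v; rewrite /base_in pureDl; apply: (congr2 (fun x y : V \otimes Lk => x + y)) => //.
by rewrite pureZl -pureZr; symmetry; rewrite [LHS]tens_mapE mklinE.
Qed.

Section Lift.
Variables (M : lmodType L) (f : {linear V -> restr M}).

Fact base_lift_bilin :
  bilin ((fun v (l : L) => l *: (f v : M)) : V -> Lk -> restr M).
Proof.
split=> [l a u v|v a l m].
  rewrite linearP [LHS]scalerDr; congr (_ + _).
  by rewrite !restrZ !scalerA mulrC.
rewrite [LHS]scalerDl; apply: (congr2 (fun x y : M => x + y)) => //.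
symmetry; exact: scalerA.
Qed.
Fact base_lift_linear : linear (tens_lift base_lift_bilin : base_ext -> M).
Proof.
pose T (x : base_ext) : M := tens_lift base_lift_bilin x.
have TD x y : T (x + y) = T x + T y by apply: (linearD (tens_lift base_lift_bilin)).
have T0 : T 0 = 0 by apply: (linear0 (tens_lift base_lift_bilin)).
suff TZ a x : T (a *: x) = a *: T x.
  by move=> a x y; rewrite -/(T _) TD TZ.
elim/tens_ind: x => [|x y hx hy|v l]; first by rewrite scaler0 T0 scaler0.
  have -> : a *: (x + y : base_ext) = a *: (x : base_ext) + a *: (y : base_ext).
    exact: scalerDr.
  by rewrite TD hx hy -scalerDr; congr (_ *: _); symmetry; apply: TD.
rewrite /T [a *: _]tens_mapE !tens_liftE mklinE; symmetry; exact: scalerA.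
Qed.
Definition base_lift : {linear base_ext -> M} := mklin base_lift_linear.
Lemma base_liftE v : base_lift (base_in v) = f v.
Proof. by rewrite mklinE [LHS]tens_liftE scale1r. Qed.
End Lift.

Lemma base_ext_ext (M : lmodType L) (f g : {linear base_ext -> M}) :
  (forall v, f (base_in v) = g (base_in v)) -> f =1 g.
Proof.
move=> h; elim/base_ext_ind => [|x y hx hy|v l]; first by rewrite !linear0.
  by rewrite !linearD hx hy.
by rewrite !linearZ h.
Qed.

End BaseExt.

Section BaseCoalgebra.
Variable C : coalgType K.
Local Notation CL := (base_ext C).

(** [C \otimes_K C -> C_L \otimes_L C_L], [c \otimes d |-> (c \otimes 1) \otimes (d \otimes 1)] *)
Fact base_square_bilin :
  bilin ((fun c d => base_in c \ot base_in d) : C -> C -> restr (CL \otimes CL)).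
Proof.
split=> [d a u v|u a v w].
  have := base_in_linear a u v; rewrite /= => ->.
  by rewrite pureDl pureZl.
have := base_in_linear a v w; rewrite /= => ->.
by rewrite pureDr pureZr.
Qed.
Definition base_square : {linear C \otimes C -> restr (CL \otimes CL)} :=
  tens_lift base_square_bilin.

(** [c \otimes l |-> l *: \sum (c_1 \otimes 1) \otimes (c_2 \otimes 1)] *)
Definition base_comul : {linear CL -> CL \otimes CL} := base_lift (base_square \o comul).

Lemma base_comulE c : base_comul (base_in c) = base_square (comul c).
Proof. by rewrite [LHS]base_liftE. Qed.

Fact iota_linear : linear (iota : K^o -> restr L^o).
Proof. by move=> a u v; rewrite rmorphD rmorphM. Qed.

(** [c \otimes l |-> counit c * l] *)
Definition base_counit : {linear CL -> L^o} := base_lift (mklin iota_linear \o counit).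

Lemma base_counitE c : base_counit (base_in c) = iota (counit c).
Proof. by rewrite [LHS]base_liftE /= mklinE. Qed.

Let base_cube_bilin :
  bilin ((fun c x => base_in c \ot base_square x) :
    C -> C \otimes C -> restr (CL \otimes (CL \otimes CL))).
Proof.
split=> [d a u v|u a v w].
  have := base_in_linear a u v; rewrite /= => ->.
  by rewrite pureDl pureZl.
by rewrite linearP [LHS]pureDr restrZ pureZr.
Qed.
Let cube := tens_lift base_cube_bilin.

Let comulA_base x :
  tens_assoc CL CL CL (tens_map base_comul idfun (base_comul x)) =
  tens_map idfun base_comul (base_comul x).
Proof.
pose f : {linear CL -> _} := tens_assoc CL CL CL \o tens_map base_comul idfun \o base_comul.
pose g : {linear CL -> _} := tens_map idfun base_comul \o base_comul.
suff : f =1 g by apply.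
apply: base_ext_ext => c; rewrite /f /g /= {f g x} base_comulE.
have hl y : tens_assoc CL CL CL (tens_map base_comul idfun (base_square y)) =
            cube (tens_assoc C C C (tens_map comul idfun y)).
  elim/tens_ind: y => [|x y hx hy|a b]; first by rewrite !linear0.
    by rewrite ![in RHS]linearD -hx -hy -!linearD.
  rewrite [base_square _]tens_liftE !tens_mapE /= base_comulE.
  elim/tens_ind: (comul a) => [|x y hx hy|p q].
  - by rewrite linear0 !pure0l !linear0.
  - by rewrite linearD !pureDl !linearD hx hy.
  - by rewrite [base_square _]tens_liftE !tens_assocE [RHS]tens_liftE [base_square _]tens_liftE.
have hr y : tens_map idfun base_comul (base_square y) =
            cube (tens_map idfun comul y).
  elim/tens_ind: y => [|x y hx hy|a b]; first by rewrite !linear0.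
    by rewrite ![in RHS]linearD -hx -hy -!linearD.
  rewrite [base_square _]tens_liftE !tens_mapE [RHS]tens_liftE.
  by rewrite base_comulE.
by rewrite hl hr comulA.
Qed.

Let counitl_base x : tens_lunit CL (tens_map base_counit idfun (base_comul x)) = x.
Proof.
pose f : {linear CL -> _} := tens_lunit CL \o tens_map base_counit idfun \o base_comul.
suff : f =1 idfun by apply.
apply: base_ext_ext => c; rewrite /f /= {f x} base_comulE.
rewrite -[in RHS](counitl c); elim/tens_ind: (comul c) => [|x y hx hy|a b].
- by rewrite !linear0; rewrite -[RHS](mklinE (@base_in_linear C)) linear0.
- by rewrite !linearD hx hy; rewrite -!(mklinE (@base_in_linear C)) linearD.
- rewrite [base_square _]tens_liftE !tens_mapE !tens_lunitE base_counitE /=.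
  by rewrite -!(mklinE (@base_in_linear C)) linearZ.
Qed.

Let counitr_base x : tens_runit CL (tens_map idfun base_counit (base_comul x)) = x.
Proof.
pose f : {linear CL -> _} := tens_runit CL \o tens_map idfun base_counit \o base_comul.
suff : f =1 idfun by apply.
apply: base_ext_ext => c; rewrite /f /= {f x} base_comulE.
rewrite -[in RHS](counitr c); elim/tens_ind: (comul c) => [|x y hx hy|a b].
- by rewrite !linear0; rewrite -[RHS](mklinE (@base_in_linear C)) linear0.
- by rewrite !linearD hx hy; rewrite -!(mklinE (@base_in_linear C)) linearD.
- rewrite [base_square _]tens_liftE !tens_mapE !tens_runitE base_counitE /=.
  by rewrite -!(mklinE (@base_in_linear C)) linearZ.
Qed.

HB.instance Definition _ :=
  isCoalgebra.Build L (base_ext C) comulA_base counitl_base counitr_base.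

End BaseCoalgebra.

End Restriction.

Definition separable (K : fieldType) (D : coalgType K) :=
  forall (L : fieldType) (iota : {rmorphism K -> L}),
    cosemisimple (base_ext iota D : coalgType L).

Record quiver := Quiver { vertex : Type ; arrow : vertex -> vertex -> Type }.

Definition quiver_locally_finite (Q : quiver) :=
  forall i j : vertex Q, finite_set [set: arrow i j].

Section Gabriel.
Variables (K : fieldType) (C : coalgType K).

Local Notation P := (quotsp (coradical C)).
Local Notation pi0 := (quot_proj (coradical C)).

Definition C1_mod_C0 : subspace P := imsp pi0 (coradical_filtration C 1).

Fact rho_l_vanish c : coradical C c -> (tens_map idfun pi0 \o comul) c = 0.
Proof.
move=> /subcoalgP; apply: (@span_eq_ext _ _ _ (tens_map idfun pi0) \0).
move=> _ [v [w [hv hw ->]]]; rewrite tens_mapE /=.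
by have /quot_proj_eq0 -> := hw; rewrite pure0r.
Qed.
Fact rho_r_vanish c : coradical C c -> (tens_map pi0 idfun \o comul) c = 0.
Proof.
move=> /subcoalgP; apply: (@span_eq_ext _ _ _ (tens_map pi0 idfun) \0).
move=> _ [v [w [hv hw ->]]]; rewrite tens_mapE /=.
by have /quot_proj_eq0 -> := hv; rewrite pure0l.
Qed.

(** The coactions of [C_1/C_0] are the restrictions of the following maps, with
    [C_0 \otimes C_1/C_0] and [C_1/C_0 \otimes C_0] seen as subspaces of
    [C \otimes C/C_0] and [C/C_0 \otimes C]. *)
Definition rho_l : {linear P -> C \otimes P} := quot_lift rho_l_vanish.
Definition rho_r : {linear P -> P \otimes C} := quot_lift rho_r_vanish.

(** For simple [D = D^i] and [E = D^j], [bipart D E] is [^i(C_1/C_0)^j]. *)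
Definition bipart_set (D E : subcoalg C) : set P :=
  [set m | [/\ C1_mod_C0 m, tens_sub D C1_mod_C0 (rho_l m) &
                            tens_sub C1_mod_C0 E (rho_r m)]].
Fact bipart_zero D E : bipart_set D E 0.
Proof. by split; rewrite ?linear0; apply: ss_zero. Qed.
Fact bipart_lin D E (a : K) m n :
  bipart_set D E m -> bipart_set D E n -> bipart_set D E (a *: m + n).
Proof. by move=> [? ? ?] [? ? ?]; split; rewrite ?linearP; apply: ss_lin. Qed.
Definition bipart D E : subspace P := Subspace (bipart_zero D E) (@bipart_lin D E).

(** The actions [f . m = \sum m_0 f(m_1)] and [m . g = \sum g(m_(-1)) m_0].
    A functional on a subcoalgebra is evaluated on the coaction after extending
    it to [C] along a linear retraction; on [bipart D E] the choice of the
    extension is irrelevant, see [lactE] and [ractE]. *)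
Definition lact (E : subcoalg C) (f : dual (subcoalg_type E)) : {linear P -> P} :=
  tens_runit P \o tens_map idfun (f \o retr E) \o rho_r.
Definition ract (D : subcoalg C) (g : dual (subcoalg_type D)) : {linear P -> P} :=
  tens_lunit P \o tens_map (g \o retr D) idfun \o rho_l.

Lemma lactE (D E : subcoalg C) (f : dual (subcoalg_type E)) (h : {linear C -> K^o}) m :
  (forall c, h (incl E c) = f c) -> bipart D E m ->
  lact f m = tens_runit P (tens_map idfun h (rho_r m)).
Proof.
move=> hf [_ _]; rewrite /lact /=; move: (rho_r m).
apply: (@span_eq_ext _ _ _ (tens_runit P \o tens_map idfun (f \o retr E))
                           (tens_runit P \o tens_map idfun h)).
move=> _ [v [w [hv hw ->]]]; rewrite /= !tens_mapE /=.
by rewrite -[in RHS](incl_retr hw) hf.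
Qed.

Lemma ractE (D E : subcoalg C) (g : dual (subcoalg_type D)) (h : {linear C -> K^o}) m :
  (forall c, h (incl D c) = g c) -> bipart D E m ->
  ract g m = tens_lunit P (tens_map h idfun (rho_l m)).
Proof.
move=> hg [_ + _]; rewrite /ract /=; move: (rho_l m).
apply: (@span_eq_ext _ _ _ (tens_lunit P \o tens_map (g \o retr D) idfun)
                           (tens_lunit P \o tens_map h idfun)).
move=> _ [v [w [hv hw ->]]]; rewrite /= !tens_mapE /=.
by rewrite -[in RHS](incl_retr hv) hg.
Qed.

Definition simple_index := {D : subcoalg C | simple_subcoalg D}.
Definition simple_at (i : simple_index) : subcoalg C := sval i.

Definition idempotent_choice :=
  {e : forall i : simple_index, dual (subcoalg_type (simple_at i)) |
    forall i, primitive_idempotent (e i)}.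

Variable e : idempotent_choice.

(** [e_i . ^j(C_1/C_0)^i . e_j] *)
Definition arrow_space (i j : simple_index) : subspace P :=
  imsp (lact (sval e i) \o ract (sval e j)) (bipart (simple_at j) (simple_at i)).

(** The [t_ij] arrows from [i] to [j] are the elements of a basis of
    [arrow_space i j]. *)
Definition gabriel_quiver : quiver :=
  @Quiver simple_index (fun i j => {x : P | basis (arrow_space i j) x}).

End Gabriel.

(* Main.v *)
Require Import Defs.
From HB Require Import structures.
From mathcomp Require Import all_boot all_order all_algebra.
From mathcomp Require Import generic_quotient boolp classical_sets functions cardinality.
Set Implicit Arguments.
Unset Strict Implicit.
Unset Printing Implicit Defensive.
(* Restores the meaning of [span] and [dual]. *)
Import Defs.
Import GRing.Theory.
Local Open Scope classical_set_scope.
Local Open Scope ring_scope.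

(** The dual algebra [C^*] acts on [C] from both sides, by [actl f c = \sum f c_1 c_2] and
    [actr g c = \sum g c_2 c_1]. Since a tensor is determined by its slices, subcoalgebras
    are the subspaces stable under both actions, and [c] lies in [V /\ W] exactly when [f]
    moves [c] into [W] for every functional [f] vanishing on [V]. All arguments below are
    about these actions.

    Suppose that [C] is locally finite, and let [D] and [E] be simple subcoalgebras; they are
    finite-dimensional. There are functionals that project the coradical [C_0] onto [D] and
    onto [E]. Acting with them on a representative in [C_1] of a class of the
    [D]-[E]-part of [C_1 / C_0] does not change the class, and moves the representative into
    [D /\ E]. Thus this part is finite-dimensional (lemma [bipart_in_wedge]), and so are the
    arrow spaces inside it.

    Suppose that the quiver is locally finite. The dual algebra of a simple coalgebra is
    simple, so that it is generated by a primitive idempotent as an ideal; hence the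
    [D]-[E]-part of [C_1 / C_0] is a finite sum of images of an arrow space and
    finite-dimensional ([finite_mod_block_of_arrows]). Splitting a finite sum [S] of simple
    subcoalgebras into its summands, one finds that [S /\ S] is finite-dimensional modulo
    [C_0], while its intersection with [C_0] is only [S] ([fin_dim_wedge_semisimple]).

    Let [X_n] be the [n]-fold wedge of [S] with itself. An element [c] of [X_(n+2)] is
    determined modulo [X_(n+1)] by the elements [actl f c] of [X_(n+1)], for the functionals
    [f] vanishing on [S], and modulo [X_n] these depend only on the restriction of [f] to the
    finite-dimensional [X_2]. Therefore all [X_n] are finite-dimensional ([fin_dim_wedges]).

    Every finite-dimensional subcoalgebra [U] lies in some [X_n], for [S] the sum of the
    simple subcoalgebras of [U] ([coideal_in_wedges]). By induction on the length, it is
    enough to see that the coefficients of a simple comodule form a simple subcoalgebra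
    ([simple_quotient_in_wedge]); this is the theorem that a primitive finite-dimensional
    algebra is simple. Two finite-dimensional subspaces lie in one such [U], their wedge in
    [U /\ U], and that in [X_n /\ X_n = X_(2n)] ([locally_finite_of_semisimple]). *)

(** * Linear algebra in arbitrary vector spaces *)

Section LinearAlgebra.
Variable K : fieldType.
Implicit Types V W X : lmodType K.

Definition kills V (f : {linear V -> K^o}) (A : set V) := forall x, A x -> f x = 0.

Lemma subspace_eq V (U W : subspace V) : U `<=` W -> W `<=` U -> U = W.
Proof. by move=> UW WU; apply: subspace_ext; apply/seteqP. Qed.

Fact zero_set_zero V : [set 0 : V] 0. Proof. by []. Qed.
Fact zero_set_lin V (a : K) (u v : V) :
  [set 0] u -> [set 0] v -> [set 0] (a *: u + v).
Proof. by move=> -> ->; rewrite /= scaler0 addr0. Qed.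
Definition zerosp V : subspace V := Subspace (zero_set_zero V) (@zero_set_lin V).

Fact capsp_zero V (U W : subspace V) : (U `&` W) 0.
Proof. by split; apply: ss_zero. Qed.
Fact capsp_lin V (U W : subspace V) (a : K) u v :
  (U `&` W) u -> (U `&` W) v -> (U `&` W) (a *: u + v).
Proof. by move=> [? ?] [? ?]; split; apply: ss_lin. Qed.
Definition capsp V (U W : subspace V) : subspace V :=
  Subspace (@capsp_zero _ U W) (@capsp_lin _ U W).

Lemma addsp_subl V (U W : subspace V) : U `<=` addsp U W.
Proof. by move=> x Ux; exists x, 0; rewrite addr0; split=> //; apply: ss_zero. Qed.

Lemma addsp_subr V (U W : subspace V) : W `<=` addsp U W.
Proof. by move=> x Wx; exists 0, x; rewrite add0r; split=> //; apply: ss_zero. Qed.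

Lemma addsp_min V (U W X : subspace V) : U `<=` X -> W `<=` X -> addsp U W `<=` X.
Proof. by move=> UX WX _ [u [w [/UX Xu /WX Xw ->]]]; apply: ssD. Qed.

Lemma span_linear V W (f : {linear V -> W}) (A : set V) (B : subspace W) :
  (forall x, A x -> B (f x)) -> forall x, span A x -> B (f x).
Proof. by move=> AB x; apply: (span_min (U := preimsp f B)). Qed.

Lemma span_cons V (x : V) s v :
  span [set` x :: s] v -> exists a : K, span [set` s] (v - a *: x).
Proof.
pose S := [set v | exists a : K, span [set` s] (v - a *: x)].
have S0 : S 0 by exists 0; rewrite scale0r subr0; apply: ss_zero.
have SL (a : K) u w : S u -> S w -> S (a *: u + w).
  move=> [b hb] [c hc]; exists (a * b + c).
  rewrite scalerDl opprD addrACA -scalerA -scalerBr; exact: ss_lin.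
move=> /(_ (Subspace S0 SL)); apply => y /=; rewrite inE => /orP[/eqP ->|ys].
  by exists 1; rewrite scale1r subrr; apply: ss_zero.
by exists 0; rewrite scale0r subr0; apply: sub_span.
Qed.

Lemma span_uniq_sum V (s : seq V) v : uniq s -> span [set` s] v ->
  exists a : V -> K, v = \sum_(y <- s) a y *: y.
Proof.
elim: s v => [|x s IH] v /=.
  move=> _ sv; exists (fun=> 0); rewrite big_nil.
  by have : zerosp V v by apply: span_min sv.
move=> /andP[xs us] /span_cons[b /(IH _ us)[a va]].
exists (fun y => if y == x then b else a y); rewrite big_cons eqxx.
rewrite -[LHS](subrK (b *: x)) addrC va; congr (_ + _); apply: eq_big_seq => y ys.
by case: eqP => // yx; rewrite -yx ys in xs.
Qed.

(** Linear maps on spaces without a chosen basis are obtained from their graphs. *)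
Lemma linear_of_graph V W (R : V -> W -> Prop) :
  (forall v, exists w, R v w) ->
  (forall (a : K) u v w w', R u w -> R v w' -> R (a *: u + v) (a *: w + w')) ->
  (forall w, R 0 w -> w = 0) ->
  exists f : {linear V -> W}, forall v, R v (f v).
Proof.
move=> Rex Rlin R0; pose f v := sval (cid (Rex v)).
have Rf v : R v (f v) := svalP (cid (Rex v)).
have Runiq v w w' : R v w -> R v w' -> w = w'.
  move=> h h'; apply/esym/eqP; rewrite -subr_eq0 addrC -scaleN1r; apply/eqP/R0.
  by rewrite -[0](addNr v) -scaleN1r; apply: Rlin.
have fL : linear f by move=> a u v; apply: Runiq (Rf _) _; apply: Rlin.
by exists (mklin fL) => v; rewrite mklinE.
Qed.

Lemma projection_exists V (A B : subspace V) : A `&` B `<=` [set 0] ->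
  exists p : {linear V -> V},
    [/\ forall v, A (p v), forall v, A v -> p v = v & forall v, B v -> p v = 0].
Proof.
move=> AB; have [W [ABW ABWT]] := complement_exists (addsp A B).
have sub_AB a b : A a -> B b -> addsp A B (a + b) by exists a, b.
pose R v a := A a /\ exists b w, [/\ B b, W w & v = a + b + w].
have R0 a : R 0 a -> a = 0.
  move=> [Aa [b [w [Bb Ww /esym/eqP]]]]; rewrite addr_eq0 => /eqP abw.
  have ab0 : a + b = 0.
    apply: ABW; split; first exact: sub_AB.
    by rewrite abw; apply: ssN.
  apply: AB; split=> //; move/eqP: ab0; rewrite addr_eq0 => /eqP ->; exact: ssN.
have [] := linear_of_graph (R := R).
- move=> v; have : addsp (addsp A B) W v by rewrite ABWT.
  by move=> [_ [w [[a [b [Aa Bb ->]]] Ww ->]]]; exists a; split=> //; exists b, w.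
- move=> c u v a a' [Aa [b [w [Bb Ww ->]]]] [Aa' [b' [w' [Bb' Ww' ->]]]].
  split; first exact: ss_lin.
  exists (c *: b + b'), (c *: w + w'); split; try exact: ss_lin.
  by rewrite !scalerDr addrACA; congr (_ + _); rewrite addrACA.
- exact: R0.
move=> p Rp; exists p; split=> v; first by have [] := Rp v.
- move=> Av; have [Ap [b [w [Bb Ww vE]]]] := Rp v; apply/esym/eqP; rewrite -subr_eq0.
  apply/eqP/R0; split; first exact: ssB.
  exists (- b), (- w); split; try exact: ssN.
  have -> : v - p v = b + w by rewrite {1}vE -[_ + b + w]addrA [LHS]addrC addKr.
  by rewrite -addrA -opprD subrr.
- move=> Bv; have [Ap [b [w [Bb Ww vE]]]] := Rp v; apply: R0; split=> //.
  exists (b - v), w; split=> //; first exact: ssB.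
  by rewrite [_ + (b - v)]addrA [RHS]addrAC -vE subrr.
Qed.

Lemma functional_extension V (A B : subspace V) (h : {linear V -> K^o}) :
  A `&` B `<=` [set 0] ->
  exists f : {linear V -> K^o}, (forall v, A v -> f v = h v) /\ kills f B.
Proof.
move=> /projection_exists[p [_ pA pB]]; exists (h \o p); split=> v hv /=.
  by rewrite pA.
by rewrite pB ?linear0.
Qed.

Lemma separating_functional V (U : subspace V) x : ~ U x ->
  exists f : {linear V -> K^o}, kills f U /\ f x = 1.
Proof.
move=> nUx; have x0 : x != 0 by apply: contra_notN nUx => /eqP ->; apply: ss_zero.
have lineP v : span [set x] v -> exists a : K, v = a *: x.
  pose S := [set v | exists a : K, v = a *: x].
  have S0 : S 0 by exists 0; rewrite scale0r.
  have SL (a : K) u w : S u -> S w -> S (a *: u + w).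
    by move=> [b ->] [c ->]; exists (a * b + c); rewrite scalerDl scalerA.
  by apply: (span_min (U := Subspace S0 SL)) => _ ->; exists 1; rewrite scale1r.
have [p [pA pid p0]] : exists p : {linear V -> V},
    [/\ forall v, span [set x] (p v), forall v, span [set x] v -> p v = v
      & forall v, U v -> p v = 0].
  apply: projection_exists => v [/lineP[a ->] Uax]; have [-> | a0] := eqVneq a 0.
    exact: scale0r.
  by case: nUx; rewrite -[x](scalerK a0); apply: ssZ.
have px : p x = x by apply: pid; apply: sub_span.
have [||| f fP] := linear_of_graph (W := K^o) (R := fun v a => p v = (a : K) *: x).
- by move=> v; have [a] := lineP _ (pA v); exists a.
- by move=> a u v b c pu pv; rewrite linearP pu pv scalerA -scalerDl.
- move=> a; rewrite linear0 => /esym/eqP; rewrite scaler_eq0 (negPf x0) orbF.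
  by move/eqP.
have inj (a b : K) : a *: x = b *: x -> a = b.
  move=> /eqP; rewrite -subr_eq0 -scalerBl scaler_eq0 (negPf x0) orbF subr_eq0.
  by move/eqP.
exists f; split=> [v Uv|].
  by apply: inj; rewrite -fP p0 // scale0r.
by apply: inj; rewrite -fP px scale1r.
Qed.

Lemma functionals_separate V (x : V) :
  (forall f : {linear V -> K^o}, f x = 0) -> x = 0.
Proof.
move=> fx; apply: contrapT => x0.
have [f [_]] := @separating_functional V (zerosp V) x x0.
by rewrite fx => /esym/eqP; rewrite oner_eq0.
Qed.

(** A functional [f] that vanishes on [U] but not at [w] does not vanish at some [x] in [s];
    the projection onto the kernel of [f] along [x] fixes [U] and kills [x]. *)
Lemma span_exchange V (U W : subspace V) w (s : seq V) :
  U `<=` W -> W w -> ~ U w -> W `<=` span [set` s] ->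
  exists t : seq V, (size t < size s)%N /\ U `<=` span [set` t].
Proof.
move=> UW Ww nUw Ws; have [f [fU fw]] := separating_functional nUw.
have [x xs fx] : exists2 x, x \in s & f x != 0.
  apply: contrapT => nx; have : f w = (\0 : {linear V -> K^o}) w.
    apply: span_eq_ext (Ws _ Ww) => y ys /=; apply/eqP; apply/negPn/negP => fy.
    by apply: nx; exists y.
  by rewrite fw => /eqP; rewrite oner_eq0.
have pL : linear (fun y => y - (f y / f x) *: x).
  move=> a u v; rewrite linearP scalerBr addrACA -opprD; congr (_ - _).
  by rewrite mulrDl scalerDl scalerA mulrA.
exists [seq mklin pL y | y <- rem x s]; rewrite size_map size_rem //.
split; first by case: (s) xs.
move=> u Uu; have <- : mklin pL u = u by rewrite mklinE fU // mul0r scale0r subr0.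
have := Ws _ (UW _ Uu); apply: span_linear => y ys; have [->|yx] := eqVneq y x.
  by rewrite mklinE divff // scale1r subrr; apply: ss_zero.
apply: sub_span; apply: map_f.
by move: ys; rewrite /= (perm_mem (perm_to_rem xs)) inE (negPf yx).
Qed.

Lemma fin_dim_of_sub_span V (U : subspace V) (s : seq V) :
  U `<=` span [set` s] -> fin_dim U.
Proof.
have [n] := ubnP (size s); elim: n s => // n IH s; rewrite ltnS => sn Us.
have [sU|/existsNP[w /not_implyP[sw nUw]]] := pselect (span [set` s] `<=` U).
  by exists s; apply: subspace_eq.
have [t [ts Ut]] := span_exchange Us sw nUw (@subset_refl _ _).
exact: IH (leq_trans ts sn) Ut.
Qed.

Lemma fin_dim_sub V (U W : subspace V) : U `<=` W -> fin_dim W -> fin_dim U.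
Proof. by move=> UW [s Ws]; apply: (@fin_dim_of_sub_span _ _ s); rewrite -Ws. Qed.

Lemma fin_dim_add V (U W : subspace V) :
  fin_dim U -> fin_dim W -> fin_dim (addsp U W).
Proof.
move=> [s ->] [t ->]; apply: (@fin_dim_of_sub_span _ _ (s ++ t)).
by apply: addsp_min; apply: span_sub => x /= xs; rewrite mem_cat xs ?orbT.
Qed.

Lemma fin_dim_im V W (f : {linear V -> W}) (U : subspace V) :
  fin_dim U -> fin_dim (imsp f U).
Proof.
move=> [s ->]; apply: (@fin_dim_of_sub_span _ _ (map f s)) => _ [x sx <-].
move: sx; apply: span_linear => y ys.
by apply: sub_span; apply: map_f.
Qed.

Lemma fin_dim_zero V : fin_dim (zerosp V).
Proof. by apply: (@fin_dim_of_sub_span _ _ [::]) => _ ->; apply: ss_zero. Qed.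

Lemma fin_dim_im_ker V W (f : {linear V -> W}) (U : subspace V) :
  fin_dim (imsp f U) -> fin_dim (capsp U (preimsp f (zerosp W))) -> fin_dim U.
Proof.
move=> [s fUs] kerf.
have [t tU ts] : exists2 t : seq V, [set` t] `<=` U & s = map f t.
  have : [set` s] `<=` f @` U.
    by move=> y ys; rewrite -[_ @` _]/(imsp f U : set _) fUs; apply: sub_span.
  elim: (s) => [|y r IH] yrU; first by exists [::].
  have [|t tU ->] := IH; first by move=> z zr; apply: yrU; rewrite /= inE zr orbT.
  have [x Ux fx] : (f @` U) y by apply: yrU; rewrite /= mem_head.
  exists (x :: t); last by rewrite /= fx.
  by move=> z /=; rewrite inE => /orP[/eqP ->|/tU].
apply: (fin_dim_sub (W := addsp (span [set` t]) (capsp U (preimsp f (zerosp W))))); last first.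
  by apply: fin_dim_add => //; exists t.
move=> u Uu; have [v tv fv] : imsp f (span [set` t]) (f u).
  have : imsp f U (f u) by exists u.
  rewrite fUs ts; apply: span_min => _ /mapP[x xt ->].
  by exists x => //; apply: sub_span.
exists v, (u - v); split=> //; last by rewrite addrC subrK.
split; first by apply: ssB => //; move: tv; apply: span_min.
by rewrite /= /preimage /= linearB fv subrr.
Qed.

(** The dimension of [U]; the junk value [0] is taken in infinite dimension. *)
Definition rk V (U : subspace V) : nat :=
  if pselect (exists n, `[< exists2 s : seq V, size s = n & U `<=` span [set` s] >])
    is left h then ex_minn h else 0.

Lemma rk_le_size V (U : subspace V) (s : seq V) :
  U `<=` span [set` s] -> (rk U <= size s)%N.
Proof.
move=> Us; rewrite /rk; case: pselect => // h; case: ex_minnP => n _; apply.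
by apply/asboolP; exists s.
Qed.

Lemma rk_lt V (U W : subspace V) : fin_dim W -> U `<=` W -> ~ (W `<=` U) ->
  (rk U < rk W)%N.
Proof.
move=> [s Ws] UW /existsNP[w /not_implyP[Ww nUw]].
rewrite {2}/rk; case: pselect => [h|[]]; last first.
  by exists (size s); apply/asboolP; exists s => //; rewrite Ws.
case: ex_minnP => _ /asboolP[t <- Wt] _.
have [r [rt Ur]] := span_exchange UW Ww nUw Wt.
exact: leq_ltn_trans (rk_le_size Ur) rt.
Qed.

Lemma free_finite V (B : set V) (s : seq V) :
  lin_indep B -> B `<=` span [set` s] -> finite_set B.
Proof.
move=> Bfree Bs; apply: contrapT => /(infinite_set_fset (size s).+1)[F FB sF].
have [b [ub bB sb]] : exists b : seq V, [/\ uniq b, [set` b] `<=` B & (size s < size b)%N].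
  exists (finmap.enum_fset F); split=> //; first exact: finmap.fset_uniq.
move: sb; apply/negP; rewrite -leqNgt.
apply: (@leq_trans (rk (span [set` b]))); last first.
  by apply: rk_le_size; apply: span_min => x /bB/Bs.
elim: b ub bB => //= x b IH /andP[xb ub] xbB.
have bB : [set` b] `<=` B by move=> y yb; apply: xbB; rewrite /= inE yb orbT.
apply: leq_ltn_trans (IH ub bB) _; apply: rk_lt; first by exists (x :: b).
  by apply: span_sub => y yb; rewrite /= inE yb orbT.
move=> /(_ x (sub_span (mem_head x b))) /(span_uniq_sum ub)[a xE].
pose c y := if y == x then -1 else a y.
have cx : c x = 0.
  apply: (Bfree (x :: b)) (mem_head x b) => //; first by rewrite /= xb.
  rewrite big_cons /c eqxx scaleN1r {1}xE addrC; apply/eqP; rewrite subr_eq0; apply/eqP.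
  by apply: eq_big_seq => y yb; case: eqP => // yx; rewrite -yx yb in xb.
by move/eqP: cx; rewrite /c eqxx oppr_eq0 oner_eq0.
Qed.

Definition lin_closed V (I : set {linear V -> K^o}) :=
  I \0 /\
  forall (a : K) (f g : {linear V -> K^o}), I f -> I g -> I (a \*: f \+ g).

Lemma lin_closed_at V (I : set {linear V -> K^o}) x :
  lin_closed I -> lin_closed [set g | I g /\ g x = 0].
Proof.
move=> [I0 Ilin]; split=> // a f g [If fx] [Ig gx]; split; first exact: Ilin.
by rewrite /= fx gx scaler0 addr0.
Qed.

Lemma functional_subZ V (f : {linear V -> K^o}) (a : K) y x :
  f (y - a *: x) = (f y : K) - a * f x.
Proof. by rewrite linearB linearZ. Qed.

Lemma functional_comb V (f g : {linear V -> K^o}) (a : K) x :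
  (a \*: f \+ g) x = a * f x + g x :> K.
Proof. by []. Qed.

Lemma normalized_functional V (I : set {linear V -> K^o}) x : lin_closed I ->
  (forall g, I g -> g x = 0) \/ exists2 g, I g & g x = 1.
Proof.
move=> [I0 Ilin].
have [?|/existsNP[g /not_implyP[Ig /eqP gx]]] := pselect (forall g, I g -> g x = 0).
  by left.
right; exists ((g x)^-1 \*: g \+ \0); first exact: Ilin.
by rewrite /= addr0; apply: mulVf.
Qed.

(** A space [I] of functionals is everything that its annihilator allows, as long as only
    finitely many vectors are tested. One vector [x] of [s] is eliminated at a time: either
    [I] vanishes at [x], or some [g0] in [I] takes the value [1] there and serves as pivot. *)
Lemma double_annihilator V (I : set {linear V -> K^o}) (s : seq V) (t : {linear V -> K^o}) :
  lin_closed I ->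
  (forall x, span [set` s] x -> (forall g, I g -> g x = 0) -> t x = 0) ->
  exists2 g, I g & forall x, x \in s -> g x = t x.
Proof.
have [n] := ubnP (size s); elim: n s I t => // n IH [|x s] I t; rewrite ltnS => sn.
  by move=> [I0 _] _; exists \0.
move=> Ilin tI; have [Ix|[g0 Ig0 g0x]] := normalized_functional x Ilin.
  have [|g Ig gs] := IH s I t sn Ilin.
    move=> y sy; apply: tI; apply: span_sub sy => z zs; by rewrite /= inE zs orbT.
  exists g => // y; rewrite inE => /orP[/eqP ->|/gs//]; rewrite Ix // tI //.
  by apply: sub_span; rewrite /= mem_head.
pose s' := [seq y - (g0 y : K) *: x | y <- s].
have [||g [Ig gx] gs'] := IH s' _ (- t x \*: g0 \+ t) _ (lin_closed_at x Ilin).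
- by rewrite size_map.
- move=> z s'z zI'.
  have g0z : g0 z = 0.
    apply: (@span_eq_ext _ _ _ g0 \0) s'z => _ /mapP[y ys ->] /=.
    by rewrite functional_subZ g0x mulr1 subrr.
  rewrite [LHS]functional_comb g0z mulr0 add0r; apply: tI => [|g Ig].
    apply: span_min s'z => _ /mapP[y ys ->]; apply: ssB; last apply: ssZ.
      by apply: sub_span; rewrite /= inE ys orbT.
    by apply: sub_span; rewrite /= mem_head.
  have : (- g x \*: g0 \+ g) z = 0.
    apply: zI'; split; first exact: Ilin.2.
    by rewrite [LHS]functional_comb g0x mulr1 addNr.
  by rewrite [LHS]functional_comb g0z mulr0 add0r.
exists (t x \*: g0 \+ g) => [|y]; first exact: Ilin.2.
rewrite inE [X in X = _]functional_comb => /orP[/eqP ->|ys]; first by rewrite g0x gx addr0 mulr1.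
have := gs' _ (map_f _ ys).
rewrite [RHS]functional_comb !functional_subZ gx g0x !mulr1 subrr !mulr0 subr0 add0r => ->.
by rewrite mulrC addrC subrK.
Qed.

(** When [f] ranges over [J], only finitely many of the maps [L f] matter modulo [Y], since
    [L f] maps [U] into [Y] as soon as [f] vanishes on the finite list [s]; and [U] embeds,
    up to the finite-dimensional [Z], into the product of their images. The induction on [s]
    splits off one pivot functional [f0] of [J] at a time. *)
Lemma fin_dim_of_family V W X (L : {linear X -> K^o} -> {linear V -> W})
    (J : set {linear X -> K^o}) (s : seq X) (U : subspace V) (Y : subspace W) :
  (forall (a : K) (f g : {linear X -> K^o}) v, L (a \*: f \+ g) v = a *: L f v + L g v) ->
  lin_closed J ->
  (forall f, J f -> fin_dim (imsp (L f) U)) ->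
  (forall f, J f -> kills f [set` s] -> forall u, U u -> Y (L f u)) ->
  (exists2 Z, fin_dim Z & forall u, U u -> (forall f, J f -> Y (L f u)) -> Z u) ->
  fin_dim U.
Proof.
move=> Llin; elim: s J U => [|x s IH] J U Jlin LU LY [Z Zfd UZ].
  by apply: fin_dim_sub Zfd => u Uu; apply: UZ => // f Jf; apply: LY.
have [Jx|[f0 Jf0 f0x]] := normalized_functional x Jlin.
  apply: (IH J) => //; last by exists Z.
  move=> f Jf fs; apply: LY => // y /=.
  by rewrite inE => /orP[/eqP ->|/fs//]; apply: Jx.
apply: (fin_dim_im_ker (LU f0 Jf0)); apply: (IH [set f | J f /\ f x = 0]).
- exact: lin_closed_at.
- move=> f [Jf _]; apply: fin_dim_sub (LU f Jf) => _ [u [Uu _] <-].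
  by exists u.
- move=> f [Jf fx] fs u [Uu _]; apply: LY => // y /=.
  by rewrite inE => /orP[/eqP ->|/fs].
- exists Z => // u [Uu]; rewrite /= /preimage /= => f0u uY; apply: UZ => // f Jf.
  have : Y (L (- f x \*: f0 \+ f) u).
    apply: uY; split; first exact: Jlin.2.
    by rewrite /= f0x scaleNr /GRing.scale /= mulr1 addNr.
  by rewrite Llin f0u scaler0 add0r.
Qed.

End LinearAlgebra.

(** * Slices of tensors *)

Section Slices.
Variable K : fieldType.
Implicit Types V W : lmodType K.

Fact lslice_linear V W (f : {linear V -> K^o}) :
  linear (tens_lunit W \o tens_map f idfun : V \otimes W -> W).
Proof. exact: linearP. Qed.
Fact rslice_linear V W (g : {linear W -> K^o}) :
  linear (tens_runit V \o tens_map idfun g : V \otimes W -> V).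
Proof. exact: linearP. Qed.

(** Sealed with [mklin], against unfolding by [/=]. *)
Definition lslice V W (f : {linear V -> K^o}) : {linear V \otimes W -> W} :=
  mklin (@lslice_linear V W f).
Definition rslice V W (g : {linear W -> K^o}) : {linear V \otimes W -> V} :=
  mklin (@rslice_linear V W g).

Lemma lslice_tens_map V W (f : {linear V -> K^o}) x :
  lslice W f x = tens_lunit W (tens_map f idfun x).
Proof. exact: mklinE. Qed.

Lemma rslice_tens_map V W (g : {linear W -> K^o}) x :
  rslice V g x = tens_runit V (tens_map idfun g x).
Proof. exact: mklinE. Qed.

Lemma lsliceE V W (f : {linear V -> K^o}) v (w : W) :
  lslice W f (v \ot w) = (f v : K) *: w.
Proof. by rewrite lslice_tens_map tens_mapE tens_lunitE. Qed.

Lemma rsliceE V W (g : {linear W -> K^o}) (v : V) w :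
  rslice V g (v \ot w) = (g w : K) *: v.
Proof. by rewrite rslice_tens_map tens_mapE tens_runitE. Qed.

Lemma lslice_comb V W (a : K) (f g : {linear V -> K^o}) (x : V \otimes W) :
  lslice W (a \*: f \+ g) x = a *: lslice W f x + lslice W g x.
Proof.
apply: (tens_ext (g := a \*: lslice W f \+ lslice W g)) => v w.
by rewrite /= !lsliceE scalerDl scalerA.
Qed.

Lemma rslice_comb V W (a : K) (f g : {linear W -> K^o}) (x : V \otimes W) :
  rslice V (a \*: f \+ g) x = a *: rslice V f x + rslice V g x.
Proof.
apply: (tens_ext (g := a \*: rslice V f \+ rslice V g)) => v w.
by rewrite /= !rsliceE scalerDl scalerA.
Qed.

Lemma lslice_map V W V' W' (p : {linear V -> V'}) (q : {linear W -> W'}) f x :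
  lslice W' f (tens_map p q x) = q (lslice W (f \o p) x).
Proof.
apply: (tens_ext (f := lslice W' f \o tens_map p q) (g := q \o lslice W (f \o p))).
by move=> v w; rewrite /= tens_mapE !lsliceE linearZ.
Qed.

Lemma rslice_map V W V' W' (p : {linear V -> V'}) (q : {linear W -> W'}) g x :
  rslice V' g (tens_map p q x) = p (rslice V (g \o q) x).
Proof.
apply: (tens_ext (f := rslice V' g \o tens_map p q) (g := p \o rslice V (g \o q))).
by move=> v w; rewrite /= tens_mapE !rsliceE linearZ.
Qed.

Lemma slices_swap V W (f : {linear V -> K^o}) (g : {linear W -> K^o}) x :
  f (rslice V g x) = g (lslice W f x).
Proof.
apply: (tens_ext (f := f \o rslice V g) (g := g \o lslice W f)) => v w.
by rewrite /= lsliceE rsliceE !linearZ /=; exact: mulrC.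
Qed.

Definition tsum V W (l : seq (V * W)) : V \otimes W := \sum_(p <- l) p.1 \ot p.2.

Lemma tsum_exists V W (x : V \otimes W) : exists l, x = tsum l.
Proof.
elim/tens_ind: x => [|_ _ [l ->] [l' ->]|v w].
- by exists [::]; rewrite /tsum big_nil.
- by exists (l ++ l'); rewrite /tsum big_cat.
- by exists [:: (v, w)]; rewrite /tsum big_seq1.
Qed.

(** A pure tensor whose left factor depends on those of [l] can be distributed over the
    terms of [l]. *)
Lemma tsum_absorb V W (l : seq (V * W)) v w : span [set` map fst l] v ->
  exists l', size l' = size l /\ v \ot w + tsum l = tsum l'.
Proof.
elim: l v => [|[v1 w1] l IH] v /=.
  move=> sv; have -> : v = 0 by apply: (span_min (U := zerosp V)) sv.
  by exists [::]; rewrite pure0l add0r.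
move=> /span_cons[a /IH[l' [sl' l'E]]]; exists ((v1, w1 + a *: w) :: l').
rewrite /= sl'; split=> //; rewrite /tsum !big_cons /= -/(tsum l) -/(tsum l') -l'E.
rewrite pureDr [LHS]addrCA -[RHS]addrA; congr (_ + _); rewrite [RHS]addrA; congr (_ + _).
by rewrite pureZr -pureZl -pureDl addrC subrK.
Qed.

(** In a sum of least length the left factors are independent, so that the right factors
    are slices. *)
Lemma lslice_separate V W (x : V \otimes W) : (forall f, lslice W f x = 0) -> x = 0.
Proof.
have [l ->] := tsum_exists x; have [n] := ubnP (size l).
elim: n l => // n IH [|[v w] l]; first by rewrite /tsum big_nil.
rewrite /= ltnS => ln; rewrite /tsum big_cons /= -/(tsum l) => slice0.
have [/tsum_absorb h|/separating_functional[f [fl fv]]] := pselect (span [set` map fst l] v).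
  by have [l' [sl' l'E]] := h w; rewrite l'E in slice0 *; apply: IH; rewrite ?sl'.
suff w0 : w = 0 by rewrite w0 pure0r add0r in slice0 *; apply: IH.
have := slice0 f; rewrite linearD lsliceE fv scale1r /tsum linear_sum big_seq big1 ?addr0 //.
move=> p pl; rewrite lsliceE fl ?scale0r //; apply: sub_span; exact: map_f.
Qed.

Lemma rslice_separate V W (x : V \otimes W) : (forall g, rslice V g x = 0) -> x = 0.
Proof.
move=> h; apply: lslice_separate => f; apply: functionals_separate => g.
by rewrite -slices_swap h linear0.
Qed.

(** The projection along [A]; composed with it, every functional vanishes on [A]. *)
Definition coproj V (A : subspace V) : {linear V -> V} := idfun \- (incl A \o retr A).

Lemma coproj_eq0 V (A : subspace V) v : A v -> coproj A v = 0.
Proof. by move=> Av; rewrite -[LHS]/(v - incl A (retr A v)) incl_retr // subrr. Qed.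

Lemma coproj_kills V (A : subspace V) (f : {linear V -> K^o}) :
  kills (f \o coproj A) A.
Proof. by move=> v Av; rewrite -[LHS]/(f (coproj A v)) coproj_eq0 // linear0. Qed.

Lemma tens_map_coprojl V W (A : subspace V) (q : {linear W -> W}) (x : V \otimes W) :
  tens_map idfun q x = tens_map (incl A \o retr A) q x + tens_map (coproj A) q x.
Proof.
apply: (tens_ext (g := tens_map (incl A \o retr A) q \+ tens_map (coproj A) q)).
by move=> v w; rewrite /= !tens_mapE -pureDl addrC subrK.
Qed.

Lemma tens_map_coprojr V W (B : subspace W) (p : {linear V -> V}) (x : V \otimes W) :
  tens_map p idfun x = tens_map p (incl B \o retr B) x + tens_map p (coproj B) x.
Proof.
apply: (tens_ext (g := tens_map p (incl B \o retr B) \+ tens_map p (coproj B))).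
by move=> v w; rewrite /= !tens_mapE -pureDr addrC subrK.
Qed.

Lemma tens_map_sub V W V' W' (p : {linear V -> V'}) (q : {linear W -> W'})
    (A : subspace V') (B : subspace W') x :
  (forall v, A (p v)) -> (forall w, B (q w)) -> tens_sub A B (tens_map p q x).
Proof.
move=> pA qB; elim/tens_ind: x => [|x y hx hy|v w].
- by rewrite linear0; apply: ss_zero.
- by rewrite linearD; apply: ssD.
- by rewrite tens_mapE; apply: tens_sub_pure.
Qed.

Lemma tens_subP V W (A : subspace V) (B : subspace W) x :
  tens_sub A B x <->
  (forall f, kills f A -> lslice W f x = 0) /\ (forall g, kills g B -> rslice V g x = 0).
Proof.
split=> [xAB|[xA xB]].
  split=> h hk; have := xAB.
    apply: (@span_eq_ext _ _ _ (lslice W h) \0) => _ [v [w [Av _ ->]]].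
    by rewrite lsliceE hk // scale0r.
  apply: (@span_eq_ext _ _ _ (rslice V h) \0) => _ [v [w [_ Bw ->]]].
  by rewrite rsliceE hk // scale0r.
have := tens_map_coprojl A idfun x; rewrite tens_map_id // => ->.
have -> : tens_map (coproj A) idfun x = 0.
  by apply: lslice_separate => f; rewrite lslice_map xA //; apply: coproj_kills.
rewrite addr0 (tens_map_coprojr B).
have -> : tens_map (incl A \o retr A) (coproj B) x = 0.
  apply: rslice_separate => g; rewrite rslice_map xB ?linear0 //; exact: coproj_kills.
by rewrite addr0; apply: tens_map_sub => ?; apply: inclP.
Qed.

Lemma rslice_kills V W (B : subspace W) (x : V \otimes W) :
  (forall g, kills g B -> rslice V g x = 0) <-> (forall f, B (lslice W f x)).
Proof.
split=> [h f|h g gB].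
  apply: contrapT => /separating_functional[g [gB]].
  by rewrite -slices_swap h // linear0 => /esym/eqP; rewrite oner_eq0.
by apply: functionals_separate => f; rewrite slices_swap gB.
Qed.

Lemma lslice_kills V W (A : subspace V) (x : V \otimes W) :
  (forall f, kills f A -> lslice W f x = 0) <-> (forall g, A (rslice V g x)).
Proof.
split=> [h g|h f fA].
  apply: contrapT => /separating_functional[f [fA]].
  by rewrite slices_swap h // linear0 => /esym/eqP; rewrite oner_eq0.
by apply: functionals_separate => g; rewrite -slices_swap fA.
Qed.

(** This is what turns wedges into statements on functionals alone. *)
Lemma wedge_tensP V W (A : subspace V) (B : subspace W) x :
  addsp (tens_sub A (full_sp W)) (tens_sub (full_sp V) B) x <->
  (forall f, kills f A -> B (lslice W f x)).
Proof.
split=> [[y [z [/tens_subP[yA _] /tens_subP[_ /rslice_kills zB] ->]]] f fA|xAB].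
  by rewrite linearD yA // add0r.
exists (tens_map (incl A \o retr A) idfun x), (tens_map (coproj A) (incl B \o retr B) x).
split; [by apply: tens_map_sub => ? //; apply: inclP..|].
have := tens_map_coprojl A idfun x; rewrite tens_map_id // => {1}->.
rewrite (tens_map_coprojr B (coproj A)); congr (_ + _).
rewrite (_ : tens_map (coproj A) (coproj B) x = 0) ?addr0 //.
apply: lslice_separate => f; rewrite lslice_map; apply: coproj_eq0.
by apply: xAB; apply: coproj_kills.
Qed.

Lemma lslice_finite V W (x : V \otimes W) :
  exists s : seq W, forall f, span [set` s] (lslice W f x).
Proof.
have [l ->] := tsum_exists x; exists (map snd l) => f.
rewrite /tsum linear_sum big_seq; apply: ss_sum => p pl.
by rewrite lsliceE; apply: ssZ; apply: sub_span; apply: map_f.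
Qed.

Lemma rslice_finite V W (x : V \otimes W) :
  exists s : seq V, forall g, span [set` s] (rslice V g x).
Proof.
have [l ->] := tsum_exists x; exists (map fst l) => g.
rewrite /tsum linear_sum big_seq; apply: ss_sum => p pl.
by rewrite rsliceE; apply: ssZ; apply: sub_span; apply: map_f.
Qed.

Lemma lslice_finite_dep V W (x : V \otimes W) :
  exists s : seq V, forall f g : {linear V -> K^o}, (forall v, v \in s -> f v = g v) ->
    lslice W f x = lslice W g x.
Proof.
have [l ->] := tsum_exists x; exists (map fst l) => f g fg.
rewrite /tsum !linear_sum !big_seq; apply: eq_bigr => p pl.
by rewrite !lsliceE fg //; apply: map_f.
Qed.

Lemma lslice_eq V W (f g : {linear V -> K^o}) : f =1 g -> lslice W f =1 lslice W g.
Proof. by move=> fg; apply: tens_ext => v w; rewrite !lsliceE fg. Qed.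

Lemma rslice_eq V W (f g : {linear W -> K^o}) : f =1 g -> rslice V f =1 rslice V g.
Proof. by move=> fg; apply: tens_ext => v w; rewrite !rsliceE fg. Qed.

End Slices.

(** * The two actions of the dual algebra on a coalgebra *)

Section Actions.
Variables (K : fieldType) (C : coalgType K).
Implicit Types (f g h : dual C) (U W : subspace C).

Fact act_linear (b : bool) f :
  linear (if b then lslice C f \o comul else rslice C f \o comul : C -> C).
Proof. by case: b; exact: linearP. Qed.

(** [act true f c = \sum f c_1 c_2] and [act false f c = \sum f c_2 c_1]; the side is a
    boolean, so that arguments valid on both sides are given once. *)
Definition act (b : bool) f : {linear C -> C} := mklin (act_linear b f).
Local Notation actl := (act true).
Local Notation actr := (act false).

Lemma actlE f c : actl f c = lslice C f (comul c). Proof. exact: mklinE. Qed.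
Lemma actrE g c : actr g c = rslice C g (comul c). Proof. exact: mklinE. Qed.

Lemma act_counit b c : act b counit c = c.
Proof.
case: b; first by rewrite actlE lslice_tens_map counitl.
by rewrite actrE rslice_tens_map counitr.
Qed.

Lemma act_swap b f g c : f (act (~~ b) g c) = g (act b f c).
Proof. by case: b; rewrite /= !(actlE, actrE) slices_swap. Qed.

Lemma counit_act b f c : counit (act b f c) = f c.
Proof. by rewrite -act_swap act_counit. Qed.

Lemma act_comb b (a : K) f g c : act b (a \*: f \+ g) c = a *: act b f c + act b g c.
Proof. by case: b; rewrite !(actlE, actrE) (lslice_comb, rslice_comb). Qed.

Lemma act0 b c : act b \0 c = 0.
Proof. by apply: functionals_separate => g; rewrite -act_swap. Qed.

Lemma act_eq b f g : f =1 g -> act b f =1 act b g.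
Proof. by move=> fg c; case: b; rewrite !(actlE, actrE); [apply: lslice_eq | apply: rslice_eq]. Qed.

Lemma act_sub b f g c : act b (f \- g) c = act b f c - act b g c.
Proof.
rewrite (@act_eq _ _ (-1 \*: g \+ f)); last by move=> x /=; rewrite scaleN1r addrC.
by rewrite act_comb scaleN1r addrC.
Qed.

Fact actl_actl f g c : actl f (actl g c) = actl (f \o actl g) c.
Proof.
rewrite !actlE; have := lslice_map idfun comul g (comul c); rewrite -comulA => e.
have {e} -> : comul (lslice C g (comul c)) =
    lslice _ g (tens_assoc C C C (tens_map comul idfun (comul c))).
  by rewrite e; congr (comul _); apply: lslice_eq.
pose F : {linear C \otimes C -> K^o} := f \o lslice C g.
transitivity (lslice C F (tens_map comul idfun (comul c))); last first.
  by rewrite lslice_map; apply: lslice_eq => x; rewrite /F /= actlE.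
move: (tens_map _ _ _); apply: (tens_ext
  (f := lslice C f \o (lslice _ g \o tens_assoc C C C)) (g := lslice C F)) => x y.
rewrite /=; elim/tens_ind: x => [|u v hu hv|u v]; first by rewrite pure0l !linear0.
  by rewrite pureDl !linearD hu hv.
have Fuv : F (u \ot v) = g u * f v :> K by rewrite /F /= lsliceE linearZ.
by rewrite tens_assocE [RHS]lsliceE Fuv lsliceE linearZ /= lsliceE scalerA.
Qed.

Fact actr_actr f g c : actr f (actr g c) = actr (f \o actr g) c.
Proof.
rewrite !actrE; have := rslice_map comul idfun g (comul c) => e.
have {e} -> : comul (rslice C g (comul c)) =
    rslice _ g (tens_map comul idfun (comul c)).
  by rewrite e; congr (comul _); apply: rslice_eq.
pose F : {linear C \otimes C -> K^o} := f \o rslice C g.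
transitivity (rslice C F (tens_assoc C C C (tens_map comul idfun (comul c)))); last first.
  by rewrite comulA rslice_map; apply: rslice_eq => x; rewrite /F /= actrE.
move: (tens_map _ _ _); apply: (tens_ext
  (f := rslice C f \o rslice _ g) (g := rslice C F \o tens_assoc C C C)) => x y.
rewrite /=; elim/tens_ind: x => [|u v hu hv|u v]; first by rewrite pure0l !linear0.
  by rewrite pureDl !linearD hu hv.
have Fvy : F (v \ot y) = g y * f v :> K by rewrite /F /= rsliceE linearZ.
by rewrite tens_assocE [RHS]rsliceE Fvy rsliceE linearZ /= rsliceE scalerA.
Qed.

Fact actl_actr f g c : actl f (actr g c) = actr g (actl f c).
Proof.
rewrite actlE actrE [RHS]actrE actlE.
have -> : comul (rslice C g (comul c)) = rslice _ g (tens_map comul idfun (comul c)).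
  by rewrite rslice_map; congr (comul _); apply: rslice_eq.
have -> : comul (lslice C f (comul c)) =
    lslice _ f (tens_assoc C C C (tens_map comul idfun (comul c))).
  by rewrite comulA lslice_map; congr (comul _); apply: lslice_eq.
move: (tens_map _ _ _); apply: (tens_ext
  (f := lslice C f \o rslice _ g) (g := rslice C g \o (lslice _ f \o tens_assoc C C C))).
move=> x y /=; elim/tens_ind: x => [|u v hu hv|u v]; first by rewrite pure0l !linear0.
  by rewrite pureDl !linearD hu hv.
rewrite tens_assocE rsliceE [lslice _ f (_ \ot _)]lsliceE !linearZ /=.
by rewrite lsliceE rsliceE !scalerA mulrC.
Qed.

(** The composite [f \o act b g] is the convolution product of [f] and [g], in the order that
    depends on the side [b]. *)
Lemma act_act b f g c : act b f (act b g c) = act b (f \o act b g) c.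
Proof. by case: b; [apply: actl_actl | apply: actr_actr]. Qed.

Lemma act_commute b f g c : act b f (act (~~ b) g c) = act (~~ b) g (act b f c).
Proof. by case: b; rewrite /= actl_actr. Qed.

Lemma wedgePl U W c : wedge U W c <-> forall f, kills f U -> W (actl f c).
Proof.
split=> [/wedge_tensP h f /h|h]; first by rewrite actlE.
by apply/wedge_tensP => f /h; rewrite actlE.
Qed.

Lemma wedgePr U W c : wedge U W c <-> forall g, kills g W -> U (actr g c).
Proof.
split=> [/wedgePl h g gW|h].
  apply: contrapT => /separating_functional[f [fU]].
  rewrite (act_swap true) gW; last exact: h.
  by move/esym/eqP; rewrite oner_eq0.
apply/wedgePl => f fU; apply: contrapT => /separating_functional[g [gW]].
rewrite -(act_swap true) fU; first by move/esym/eqP; rewrite oner_eq0.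
exact: h.
Qed.

(** * Subcoalgebras as stable subspaces *)

(** The subspaces that carry a subcoalgebra, see [subcoalg_stable] and [stable_comul]. *)
Definition stable U := forall b f c, U c -> U (act b f c).

Lemma subcoalg_stable (D : subcoalg C) : stable D.
Proof.
move=> b h c /subcoalgP/tens_subP[/lslice_kills Dl /rslice_kills Dr].
by case: b; rewrite (actlE, actrE).
Qed.

Fact stable_comul U : stable U -> forall c, U c -> tens_sub U U (comul c).
Proof.
move=> stU c Uc; apply/tens_subP; split.
  by apply/lslice_kills => g; rewrite -actrE; apply: stU.
by apply/rslice_kills => f; rewrite -actlE; apply: stU.
Qed.
Definition stable_subcoalg U (stU : stable U) : subcoalg C :=
  Subcoalg (stable_comul stU).

Lemma stable_zero : stable (zerosp C).
Proof. by move=> b h _ ->; rewrite /= linear0. Qed.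

Lemma stable_cap U W : stable U -> stable W -> stable (capsp U W).
Proof. by move=> stU stW b h c [Uc Wc]; split; [apply: stU | apply: stW]. Qed.

Lemma stable_add U W : stable U -> stable W -> stable (addsp U W).
Proof.
move=> stU stW b h _ [u [w [Uu Ww ->]]]; rewrite linearD.
by exists (act b h u), (act b h w); split=> //; [apply: stU | apply: stW].
Qed.

Lemma stable_wedge U W : stable U -> stable W -> stable (wedge U W).
Proof.
move=> stU stW b h c /wedgePl cUW; apply/wedgePl => f fU; case: b.
  rewrite act_act; apply: cUW => x Ux /=; apply: fU; exact: stU.
by rewrite (act_commute true); apply: stW; apply: cUW.
Qed.

Lemma actl_fin_dim U : fin_dim U -> exists s : seq C, forall x f, U x -> span [set` s] (actl f x).
Proof.
move=> [t ->]; elim: t => [|y t [s IH]].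
  exists [::] => x f; apply: span_linear => z; by [].
have [r hr] := lslice_finite (comul y); exists (r ++ s) => x f.
apply: span_linear => z /=; rewrite inE => /orP[/eqP ->|zt].
  rewrite actlE; apply: span_sub (hr f) => w /= wr; by rewrite mem_cat wr.
by apply: span_sub (IH z f (sub_span zt)) => w /= ws; rewrite mem_cat ws orbT.
Qed.

(** The fundamental theorem on coalgebras: the subbimodule of [C] generated by an element is
    finite-dimensional, as the coefficients of a finite sum of tensors. *)
Lemma fin_dim_in_stable U : fin_dim U ->
  exists W, [/\ stable W, fin_dim W & U `<=` W].
Proof.
move=> [s ->]; elim: s => [|c s [W [stW fdW sW]]].
  by exists (zerosp C); split; [apply: stable_zero|apply: fin_dim_zero|apply: span_min].
pose A := [set x | exists f g, x = actl f (actr g c)].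
have stA : stable (span A).
  move=> b h x; apply: span_linear => _ [f [g ->]]; apply: sub_span; case: b.
    by exists (h \o actl f), g; rewrite act_act.
  by exists f, (h \o actr g); rewrite -(act_commute true) act_act.
have fdA : fin_dim (span A).
  have [r hr] := rslice_finite (comul c).
  have [t ht] := @actl_fin_dim (span [set` r]) (ex_intro _ r (erefl _)).
  apply: (@fin_dim_of_sub_span _ _ _ t); apply: span_min => _ [f [g ->]].
  by apply: ht; rewrite actrE.
exists (addsp (span A) W); split; [exact: stable_add | exact: fin_dim_add |].
suff cs x : x \in c :: s -> addsp (span A) W x by apply: span_min => x /cs.
rewrite inE => /orP[/eqP ->|xs]; last by apply: addsp_subr; apply: sW; apply: sub_span.
by apply: addsp_subl; apply: sub_span; exists counit, counit; rewrite !act_counit.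
Qed.

Lemma simple_stable_sub (D : subcoalg C) U : simple_subcoalg D -> stable U -> U `<=` D ->
  U `<=` [set 0] \/ D `<=` U.
Proof.
by move=> [_ Dsimple] stU /(Dsimple (stable_subcoalg stU))[] /= ->; [left|right].
Qed.

Lemma simple_cap (D : subcoalg C) U : simple_subcoalg D -> stable U ->
  D `&` U `<=` [set 0] \/ D `<=` U.
Proof.
move=> sD stU; have stDU := stable_cap (@subcoalg_stable D) stU.
have [x []|DU|DU] := simple_stable_sub sD stDU; [by []|by left|right].
by move=> x /DU[].
Qed.

Lemma simple_fin_dim (D : subcoalg C) : simple_subcoalg D -> fin_dim D.
Proof.
move=> sD; have [[d Dd d0] _] := sD.
have [W [stW fdW dW]] := @fin_dim_in_stable (span [set` [:: d]]) (ex_intro _ _ (erefl _)).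
apply: (fin_dim_sub (W := W)) => //; have [DW|//] := simple_cap sD stW.
case: d0; apply: DW; split=> //; apply: dW; apply: sub_span; exact: mem_head.
Qed.

Lemma act_counit_on b U f c : stable U -> (forall x, U x -> f x = counit x) -> U c ->
  act b f c = c.
Proof.
move=> stU fU Uc; apply/eqP; rewrite -subr_eq0; apply/eqP/functionals_separate => g.
by rewrite linearB -act_swap fU ?counit_act ?subrr //; apply: stU.
Qed.

Lemma act_kills b U f c : stable U -> kills f U -> U c -> act b f c = 0.
Proof.
by move=> stU fU Uc; apply: functionals_separate => g; rewrite -act_swap fU //; apply: stU.
Qed.

End Actions.
Notation actl := (act true).
Notation actr := (act false).

(** * Semisimple sums and counit functionals *)

Section Semisimple.
Variables (K : fieldType) (C : coalgType K).
Implicit Types (D E : subcoalg C) (U W : subspace C) (Q : set (subcoalg C)).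

Inductive finite_sum Q : subspace C -> Prop :=
| finite_sum_nil : finite_sum Q (zerosp C)
| finite_sum_cons D U : Q D -> finite_sum Q U -> finite_sum Q (addsp D U).

Lemma finite_sum_stable Q U : finite_sum Q U -> stable U.
Proof.
elim=> [|D W _ _ stW]; first exact: stable_zero.
by apply: stable_add => //; exact: subcoalg_stable.
Qed.

Lemma finite_sum_join Q U W : finite_sum Q U -> finite_sum Q W ->
  exists2 Z, finite_sum Q Z & U `<=` Z /\ W `<=` Z.
Proof.
move=> QU QW; elim: QU => [|D X QD _ [Z QZ [XZ WZ]]].
  by exists W => //; split=> // _ ->; apply: ss_zero.
exists (addsp D Z); first exact: finite_sum_cons.
split; last by move=> x /WZ Zx; apply: addsp_subr.
by apply: addsp_min => x h; [apply: addsp_subl | apply: addsp_subr; apply: XZ].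
Qed.

Lemma span_finite_sum Q x :
  span (\bigcup_(D in Q) (D : set C)) x -> exists2 U, finite_sum Q U & U x.
Proof.
pose S := [set x | exists2 U, finite_sum Q U & U x].
have S0 : S 0 by exists (zerosp C); [exact: finite_sum_nil | apply: ss_zero].
have SL (a : K) u w : S u -> S w -> S (a *: u + w).
  move=> [U QU Uu] [W QW Ww]; have [Z QZ [UZ WZ]] := finite_sum_join QU QW.
  by exists Z => //; apply: ss_lin; [apply: UZ | apply: WZ].
apply: (span_min (U := Subspace S0 SL)) => y [D QD Dy].
by exists (addsp D (zerosp C)); [do 2?constructor | apply: addsp_subl].
Qed.

Lemma fin_dim_finite_sum Q W :
  fin_dim W -> W `<=` span (\bigcup_(D in Q) (D : set C)) ->
  exists2 U, finite_sum Q U & W `<=` U.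
Proof.
move=> [s ->]; elim: s => [_|x s IH sQ].
  by exists (zerosp C); [constructor | apply: span_min].
have [|U QU sU] := IH.
  by apply: subset_trans sQ; apply: span_sub => y ys; rewrite /= inE ys orbT.
have [X QX Xx] := span_finite_sum (sQ x (sub_span (mem_head x s))).
have [Z QZ [UZ XZ]] := finite_sum_join QU QX; exists Z => //.
suff xsZ y : y \in x :: s -> Z y by apply: span_min => y /xsZ.
by rewrite inE => /orP[/eqP ->|ys]; [apply: XZ | apply: UZ; apply: sU; apply: sub_span].
Qed.

(** The comultiplication of [E + U] has its values in [E \otimes E + U \otimes U];
    a functional that is the counit on [D] and vanishes on [U] sends it to [E]. *)
Lemma simple_sub_sum D E U : simple_subcoalg D -> stable U ->
  D `<=` addsp E U -> D `<=` E \/ D `<=` U.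
Proof.
move=> sD stU DEU; have [DU|] := simple_cap sD stU; last by right.
have [f [fD fU]] := functional_extension counit DU; left=> d Dd.
rewrite -(act_counit_on true (@subcoalg_stable _ _ D) fD Dd).
have [x [y [Ex Uy ->]]] := DEU d Dd.
rewrite linearD (act_kills _ stU fU Uy) addr0; exact: subcoalg_stable.
Qed.

Lemma simple_sub_finite_sum D Q U : simple_subcoalg D -> finite_sum Q U ->
  D `<=` U -> exists2 E, Q E & D `<=` E.
Proof.
move=> sD; elim=> [D0|E W QE QW IH DEW].
  by have [[d Dd]] := sD; case; apply: D0.
have [DE|/IH//] := simple_sub_sum sD (finite_sum_stable QW) DEW; by exists E.
Qed.

Lemma simple_sub_simple D E : simple_subcoalg D -> simple_subcoalg E ->
  D `<=` E -> E `<=` D.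
Proof.
move=> [[d Dd d0] _] sE /(simple_stable_sub sE (@subcoalg_stable _ _ D))[D0|//].
by case: d0; apply: D0.
Qed.

(** The simple subcoalgebras are independent, hence there is a functional that is the counit
    on [D] and vanishes on the others; it projects [C_0] onto [D], from both sides. *)
Lemma counit_of_simple D : simple_subcoalg D ->
  exists h : dual C, (forall x, D x -> h x = counit x) /\
    forall b x, coradical C x -> D (act b h x).
Proof.
move=> sD; pose Q := [set E | simple_subcoalg E /\ ~ (D `<=` E)].
have DQ : D `&` span (\bigcup_(E in Q) (E : set C)) `<=` [set 0].
  move=> x [Dx /span_finite_sum[U QU Ux]].
  have [DU|DU] := simple_cap sD (finite_sum_stable QU); first exact: DU.
  by have [E [_ nDE] /nDE] := simple_sub_finite_sum sD QU DU.
have [h [hD hQ]] := functional_extension counit DQ; exists h; split=> // b x.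
apply: span_linear => y [E sE Ey]; have [DE|nDE] := pselect (D `<=` E).
  by apply: subcoalg_stable; apply: (simple_sub_simple sD sE DE).
rewrite (act_kills b (@subcoalg_stable _ _ E) _ Ey); first exact: ss_zero.
by move=> z Ez; apply: hQ; apply: sub_span; exists E.
Qed.

(** An element of [C_0] in [U /\ U] has no component [d] in a simple [D] outside [U]: a
    functional that is the counit on [D] and vanishes on [U] takes the element to [d], but
    takes [U /\ U] to [U]. *)
Lemma wedge_coradical U : finite_sum (@simple_subcoalg _ C) U ->
  forall c, wedge U U c -> coradical C c -> U c.
Proof.
move=> sU c Uc /span_finite_sum[W sW Wc]; have stU := finite_sum_stable sU.
have {Wc} : addsp U W c by apply: addsp_subr.
elim: sW => [|D X sD sX IH] [u [w [Uu]]]; first by move=> -> ->; rewrite addr0.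
move=> [d [x [Dd Xx ->]]] cE; apply: IH.
have stUX := stable_add stU (finite_sum_stable sX).
have UXux : addsp U X (u + x) by exists u, x.
have -> : c = d + (u + x) by rewrite cE addrCA.
apply: ssD => //; have [DUX|] := simple_cap sD stUX; last by apply.
have [h [hD hUX]] := functional_extension counit DUX.
apply: addsp_subl.
rewrite -(act_counit_on true (@subcoalg_stable _ _ D) hD Dd) -[act _ _ _]addr0.
rewrite -(act_kills true stUX hUX UXux) -linearD addrCA -cE.
by move/wedgePl: Uc; apply => y Uy; apply: hUX; apply: addsp_subl.
Qed.

End Semisimple.

(** * Finiteness modulo the coradical *)

Section ModuloCoradical.
Variables (K : fieldType) (C : coalgType K).
Implicit Types (D E : subcoalg C) (U W X Y Z : subspace C).
Local Notation C0 := (coradical C).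
Local Notation pi := (quot_proj C0).

Definition finite_mod U := fin_dim (imsp pi U).

Lemma quot_proj_eq x y : C0 (x - y) -> pi x = pi y.
Proof. by move=> /quot_proj_eq0/eqP; rewrite linearB subr_eq0 => /eqP. Qed.

Lemma finite_mod_sub U W : (forall u, U u -> exists2 w, W w & C0 (u - w)) ->
  finite_mod W -> finite_mod U.
Proof.
move=> UW; apply: fin_dim_sub => _ [u /UW[w Ww uw] <-]; exists w => //.
exact/esym/quot_proj_eq.
Qed.

Lemma finite_mod_add U W : finite_mod U -> finite_mod W -> finite_mod (addsp U W).
Proof.
move=> fU fW; apply: fin_dim_sub (fin_dim_add fU fW) => _ [_ [u [w [Uu Ww ->]]] <-].
by exists (pi u), (pi w); rewrite linearD; split=> //; [exists u | exists w].
Qed.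

Lemma finite_mod_act b f U : finite_mod U -> finite_mod (imsp (act b f) U).
Proof.
have h c : C0 c -> (pi \o act b f) c = 0.
  by move=> C0c; apply/quot_proj_eq0; apply: subcoalg_stable.
move=> /(fin_dim_im (quot_lift h)); apply: fin_dim_sub => _ [_ [u Uu <-] <-].
by exists (pi u); [exists u | rewrite quot_liftE].
Qed.

(** The two-sided ideal generated by [h] contains a functional that is the counit on [D],
    since its annihilator in [D] is a proper subcoalgebra. In the language of the dual
    algebra of [D]: it is simple, hence generated by any nonzero element as an ideal. *)
Lemma finite_mod_of_act_simple b D (h : dual C) Z :
  simple_subcoalg D -> ~ kills h D ->
  (forall f c, Z c -> Z (act b f c)) ->
  (forall f c, kills f D -> Z c -> C0 (act b f c)) ->
  finite_mod (imsp (act b h) Z) -> finite_mod Z.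
Proof.
move=> sD hD actZ DZ hZ; have [s Ds] := simple_fin_dim sD.
(* [I] is closed under linear combinations and contains all two-sided multiples of [h]. *)
pose I : set (dual C) := [set t | finite_mod (imsp (act b t) Z)].
have [|x Dx Ix|t It ts] := @double_annihilator _ _ I s counit.
- split.
    apply: fin_dim_sub (fin_dim_zero _) => _ [_ [z _ <-] <-].
    by rewrite act0 linear0.
  move=> a f g fZ gZ; apply: finite_mod_sub (finite_mod_add fZ gZ) => _ [z Zz <-].
  exists (act b (a \*: f \+ g) z); last by rewrite subrr; apply: ss_zero.
  exists (act b f (a *: z)), (act b g z); rewrite act_comb linearZ; split=> //.
    by exists (a *: z) => //; [apply: ssZ | rewrite linearZ].
  by exists z.
- pose N0 := [set y | D y /\ forall f, act b h (act b f y) = 0].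
  have N00 : N0 0 by split; [apply: ss_zero | move=> f; rewrite !linear0].
  have N0L (a : K) u w : N0 u -> N0 w -> N0 (a *: u + w).
    move=> [Du hu] [Dw hw]; split; first exact: ss_lin.
    by move=> f; rewrite !linearP hu hw scaler0 addr0.
  pose N := Subspace N00 N0L.
  have stN : stable N.
    move=> b' f y [Dy hy]; split; first exact: subcoalg_stable.
    move=> g; have [<-|b'b] := eqVneq b b'; first by rewrite (act_act b g f).
    have -> : b' = ~~ b by move: b'b; case: (b) (b') => [] [].
    by rewrite !act_commute hy linear0.
  have [y []//|N_0|DN] := simple_stable_sub sD stN.
    suff -> : x = 0 by rewrite linear0.
    apply: N_0; split=> [|f]; first by rewrite Ds.
    apply: functionals_separate => g; rewrite act_act -act_swap -act_swap.
    have := Ix ((g \o act b h) \o act b f); rewrite /= => <-.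
      by rewrite act_swap act_swap act_act.
    have : finite_mod (imsp (act b (g \o act b h)) Z).
      apply: finite_mod_sub (finite_mod_act b g hZ) => _ [z Zz <-].
      exists (act b g (act b h z)); first by exists (act b h z) => //; exists z.
      by rewrite act_act subrr; apply: ss_zero.
    apply: finite_mod_sub => _ [z Zz <-].
    exists (act b (g \o act b h) (act b f z)); first by exists (act b f z) => //; apply: actZ.
    by rewrite act_act subrr; apply: ss_zero.
  case: hD => y /DN[Dy] /(_ counit); rewrite act_counit => hy0.
  by rewrite -(counit_act b) hy0 linear0.
have tD y : D y -> (counit \- t) y = 0.
  rewrite Ds; apply: (@span_eq_ext _ _ _ (counit \- t) \0) => z zs /=.
  by rewrite ts // subrr.
apply: finite_mod_sub It => z Zz; exists (act b t z); first by exists z.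
rewrite -[X in X - _](act_counit b) -act_sub; exact: DZ.
Qed.

(** The preimage in [C] of the part of [C / C_0] that has its left coefficients in [X] and
    its right coefficients in [Y]; see [bipart_pi]. *)
Definition block X Y : subspace C := capsp (wedge X C0) (wedge C0 Y).

Lemma block_stable X Y : stable X -> stable Y -> stable (block X Y).
Proof.
move=> stX stY; have st0 := @subcoalg_stable _ _ C0.
by apply: stable_cap; apply: stable_wedge.
Qed.

Lemma blockP X Y c : block X Y c <->
  (forall f, kills f X -> C0 (actl f c)) /\ (forall g, kills g Y -> C0 (actr g c)).
Proof. by split=> -[/wedgePl h /wedgePr h']. Qed.

(** The functional [h] is the counit on [D] and vanishes on [U]; when [D] lies in [U], there
    is nothing to split off and [h] is zero. *)
Lemma split_off_simple b D U c : simple_subcoalg D -> stable U ->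
  (forall f, kills f (addsp D U) -> C0 (act b f c)) ->
  exists h, (forall f, kills f D -> C0 (act b f (act b h c))) /\
            (forall f, kills f U -> C0 (act b f (c - act b h c))).
Proof.
move=> sD stU DUc; have stD := @subcoalg_stable _ _ D.
have [DU|DU] := simple_cap sD stU; last first.
  exists \0; rewrite act0 subr0; split=> f fk; first by rewrite linear0; apply: ss_zero.
  by apply: DUc => _ [d [u [Dd Uu ->]]]; rewrite linearD !fk ?addr0 //; apply: DU.
have [h [hD hU]] := functional_extension counit DU; exists h; split=> f fk.
  rewrite act_act; apply: DUc => _ [d [u [Dd Uu ->]]].
  by rewrite linearD /= (act_kills _ stU hU Uu) linear0 addr0 fk //; apply: stD.
rewrite linearB act_act -act_sub; apply: DUc => _ [d [u [Dd Uu ->]]].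
rewrite linearD /= (act_counit_on _ stD hD Dd) subrr add0r (act_kills _ stU hU Uu).
by rewrite linear0 subr0 fk.
Qed.

(** Functionals that separate the simple summands decompose a block into those of the pairs
    of summands, modulo [C_0]. *)
Lemma finite_mod_block U W :
  (forall D E, simple_subcoalg D -> simple_subcoalg E -> finite_mod (block D E)) ->
  finite_sum (@simple_subcoalg _ C) U -> finite_sum (@simple_subcoalg _ C) W ->
  finite_mod (block U W).
Proof.
move=> fDE sU sW.
have zero_mod (Z : subspace C) : (forall c, Z c -> C0 c) -> finite_mod Z.
  move=> Z0; apply: finite_mod_sub (fin_dim_im pi (fin_dim_zero C)) => c /Z0 C0c.
  by exists 0; rewrite ?subr0 //; apply: ss_zero.
elim: sU => {U} [|D U sD sU IHU].
  apply: zero_mod => c /blockP[h _]; rewrite -(act_counit true c).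
  by apply: h => _ ->; rewrite linear0.
have stU := finite_sum_stable sU.
apply: (finite_mod_sub (W := addsp (block D W) (block U W))).
  move=> c /blockP[cl cr]; have [h [hD hU]] := split_off_simple sD stU cl.
  exists c; last by rewrite subrr; apply: ss_zero.
  have hr g : kills g W -> C0 (actr g (actl h c)).
    by move=> gW; rewrite -(act_commute true); apply: subcoalg_stable; apply: cr.
  exists (actl h c), (c - actl h c); split; last by rewrite addrC subrK.
    by apply/blockP; split.
  apply/blockP; split=> // g gW; rewrite linearB; apply: ssB; first exact: cr.
  exact: hr.
apply: finite_mod_add => //; elim: sW {IHU} => {W} [|E W sE sW IHW].
  apply: zero_mod => c /blockP[_ h]; rewrite -(act_counit false c).
  by apply: h => _ ->; rewrite linear0.
have stW := finite_sum_stable sW.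
apply: finite_mod_sub (finite_mod_add (fDE D E sD sE) IHW).
move=> c /blockP[cl cr]; have [h [hE hW]] := split_off_simple sE stW cr.
exists c; last by rewrite subrr; apply: ss_zero.
have hl g : kills g D -> C0 (actl g (actr h c)).
  by move=> gD; rewrite (act_commute true); apply: subcoalg_stable; apply: cl.
exists (actr h c), (c - actr h c); split; last by rewrite addrC subrK.
  by apply/blockP; split.
apply/blockP; split=> // g gW; rewrite linearB; apply: ssB; first exact: cl.
exact: hl.
Qed.

Lemma finite_sum_coradical U : finite_sum (@simple_subcoalg _ C) U -> U `<=` C0.
Proof.
elim=> [_ ->|D W sD _ WC]; first exact: ss_zero.
by apply: addsp_min => // x; apply: simple_sub_coradical.
Qed.

Lemma finite_sum_fin_dim U : finite_sum (@simple_subcoalg _ C) U -> fin_dim U.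
Proof.
elim=> [|D W sD _ fdW]; first exact: fin_dim_zero.
by apply: fin_dim_add => //; apply: simple_fin_dim.
Qed.

(** Modulo [C_0] the wedge lies in a block, and its part in [C_0] is [U]. *)
Lemma fin_dim_wedge_semisimple U :
  (forall D E, simple_subcoalg D -> simple_subcoalg E -> finite_mod (block D E)) ->
  finite_sum (@simple_subcoalg _ C) U -> fin_dim (wedge U U).
Proof.
move=> fDE sU; apply: (@fin_dim_im_ker _ _ _ pi).
  apply: finite_mod_sub (finite_mod_block fDE sU sU) => c cU.
  exists c; last by rewrite subrr; apply: ss_zero.
  apply/blockP; split=> h hU; apply: (finite_sum_coradical sU).
    by move/wedgePl: cU; apply.
  by move/wedgePr: cU; apply.
apply: fin_dim_sub (finite_sum_fin_dim sU) => c [Uc /quot_proj_eq0 C0c].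
exact: wedge_coradical Uc C0c.
Qed.

End ModuloCoradical.

(** * Iterated wedges *)

Section WedgePowers.
Variables (K : fieldType) (C : coalgType K).
Implicit Types (D E : subcoalg C) (S U W X Y N : subspace C) (f g h : dual C).

Definition wedges S X n : subspace C := iter n (wedge S) X.

Lemma wedgesS S X n c :
  wedges S X n.+1 c <-> forall f, kills f S -> wedges S X n (actl f c).
Proof. exact: wedgePl. Qed.

Lemma wedgesD S X m n : wedges S X (m + n) = wedges S (wedges S X n) m.
Proof. exact: iterD. Qed.

Lemma wedges_mono S X Y n : X `<=` Y -> wedges S X n `<=` wedges S Y n.
Proof.
move=> XY; elim: n => // n IH c /wedgesS h; apply/wedgesS => f /h; exact: IH.
Qed.

Lemma killers_closed (A : set C) : lin_closed [set f : dual C | kills f A].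
Proof.
split=> // a f g fA gA x Ax; by rewrite /= fA ?gA // scaler0 addr0.
Qed.

Lemma wedges1_sub S : wedges S (zerosp C) 1 `<=` S.
Proof.
move=> c /wedgesS h; apply: contrapT => /separating_functional[f [/h f0 f1]].
by move: f1; rewrite -(counit_act true) f0 linear0 => /esym/eqP; rewrite oner_eq0.
Qed.

(** On a finite set, a functional that vanishes on [S /\ S] is a sum of products of two
    functionals that vanish on [S]; such products lower the exponent by two. *)
Lemma actl_kills_wedge S X n f c : kills f (wedge S S) ->
  wedges S X n.+2 c -> wedges S X n (actl f c).
Proof.
move=> fSS cn; have [s sP] := lslice_finite_dep (comul c).
have [||g Ig gs] := @double_annihilator _ _ [set g | wedges S X n (actl g c)] s f.
- split=> [|a g h /= hg hh]; first by rewrite /= act0; apply: ss_zero.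
  by rewrite act_comb; apply: ss_lin.
- move=> x _ Ix; apply: fSS; apply/wedgePl => g gS; apply: contrapT.
  move=> /separating_functional[h [hS]].
  have -> : h (actl g x) = 0.
    have /wedgesS cg := (wedgesS _ _ _ _).1 cn g gS.
    by apply: (Ix (h \o actl g)); rewrite /= -act_act; apply: cg.
  by move=> /esym/eqP; rewrite oner_eq0.
by rewrite actlE (sP f g) -?actlE // => v vs; rewrite gs.
Qed.

(** Write [X_n] for the iterated wedges. The functionals [f] that vanish on [S] map
    [X_(n+2)] to [X_(n+1)], and to [X_n] if they vanish on the finite-dimensional [X_2]; and
    the elements of [X_(n+2)] that all of them map to [X_n] lie in [X_(n+1)]. *)
Lemma fin_dim_wedges S n : fin_dim S -> fin_dim (wedge S S) ->
  fin_dim (wedges S (zerosp C) n).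
Proof.
move=> fdS fdSS; have [m] := ubnP n; elim: m n => // m IH [|[|n]]; rewrite ltnS => nm.
- exact: fin_dim_zero.
- exact: fin_dim_sub (@wedges1_sub S) fdS.
have [s SSs] := fdSS.
apply: (@fin_dim_of_family _ _ _ _ (act true) [set f | kills f S] s _
         (wedges S (zerosp C) n)).
- exact: act_comb.
- exact: killers_closed.
- move=> f fS; apply: fin_dim_sub (IH n.+1 nm) => _ [c cn <-].
  by move/wedgesS: cn; apply.
- move=> f fS fs c cn; apply: actl_kills_wedge cn; rewrite SSs.
  by apply: (@span_eq_ext _ _ _ f \0).
- by exists (wedges S (zerosp C) n.+1); [exact: IH | move=> c _ cn; apply/wedgesS].
Qed.

(** One half of the associativity of the wedge. *)
Lemma wedges_wedge S X m n c :
  (forall f, kills f (wedges S (zerosp C) m) -> wedges S X n (actl f c)) ->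
  wedges S X (m + n) c.
Proof.
elim: m c => [|m IH] c h.
  by rewrite -[c](act_counit true); apply: h => _ ->; rewrite linear0.
rewrite addSn; apply/wedgesS => g gS; apply: IH => f fm; rewrite act_act; apply: h.
by move=> x /wedgesS xm; apply: fm; apply: xm.
Qed.

(** * Coefficients of simple comodules *)

(** The subspaces [N] whose comultiplication lies in [C \otimes N]. A left comodule is met
    below as a quotient [N / X] of two of them. *)
Definition left_coideal N := forall f c, N c -> N (actl f c).

Definition multiplicative (J : set (dual C)) :=
  lin_closed J /\ forall h f, J f -> J (h \o actl f).

Section SimpleQuotient.
Variables (X N : subspace C).
Hypotheses (coX : left_coideal X) (coN : left_coideal N) (XN : X `<=` N).
Hypothesis simpleN :
  forall Y, left_coideal Y -> X `<=` Y -> Y `<=` N -> Y `<=` X \/ N `<=` Y.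

(** With [J'] the set of the [f] in [J] that annihilate [ns] modulo [X], the subspace [J' y]
    of the simple module [N / X] is a submodule, hence everything unless it is zero. *)
Lemma orbit_full (J : set (dual C)) (ns : seq C) y z : multiplicative J -> N y ->
  (exists2 f, J f & (forall n, n \in ns -> X (actl f n)) /\ ~ X (actl f y)) -> N z ->
  exists2 f, J f & (forall n, n \in ns -> X (actl f n)) /\ X (z - actl f y).
Proof.
move=> [[J0 JL] Jmul] Ny [f0 Jf0 [f0ns f0y]].
pose T := [set z | exists2 f, J f &
  (forall n, n \in ns -> X (actl f n)) /\ X (z - actl f y)].
have T0 : T 0.
  exists \0 => //; split=> [n _|]; first by rewrite act0; apply: ss_zero.
  by rewrite act0 subr0; apply: ss_zero.
have TL (a : K) u v : T u -> T v -> T (a *: u + v).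
  move=> [f Jf [fns fy]] [g Jg [gns gy]]; exists (a \*: f \+ g); first exact: JL.
  split=> [n nns|]; rewrite act_comb.
    by apply: ss_lin; [apply: fns | apply: gns].
  by rewrite opprD addrACA -scalerBr; apply: ss_lin.
pose TS := Subspace T0 TL.
have [||| TX|NT /NT//] := simpleN (Y := TS).
- move=> h u [f Jf [fns fy]]; exists (h \o actl f); first exact: Jmul.
  split=> [n nns|]; rewrite -act_act; first by apply: coX; apply: fns.
  by rewrite -linearB; apply: coX.
- move=> u Xu; exists \0 => //; split=> [n _|]; rewrite act0; first exact: ss_zero.
  by rewrite subr0.
- move=> u [f Jf [fns fy]]; rewrite -[u](subrK (actl f y)).
  by apply: ssD; [apply: XN | apply: coN].
case: f0y; apply: TX; exists f0 => //; split=> //; rewrite subrr; exact: ss_zero.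
Qed.

(** The annihilator of [E] is an ideal of the dual algebra. If it acts nontrivially on the
    simple module [N / X], it contains local identities: as in the density theorem, an
    element that is right on [ns] is corrected at one further vector [y]. Either some
    functional annihilates [ns] but not [y], and then the ideal has room for the correction;
    or [y] is right already, since [counit - j] annihilates [ns]. *)
Lemma local_identity E j0 n0 (ns : seq C) :
  kills j0 E -> N n0 -> ~ X (actl j0 n0) -> [set` ns] `<=` N ->
  exists2 j, kills j E & forall n, n \in ns -> X (actl j n - n).
Proof.
move=> j0E Nn0 j0n0; elim: ns => [_|y ns IH nsN]; first by exists \0.
have Ny : N y by apply: nsN; rewrite /= mem_head.
have [|j jE jns] := IH; first by move=> n nns; apply: nsN; rewrite /= inE nns orbT.
have stE := @subcoalg_stable _ _ E.
have mulE : multiplicative [set f | kills f E].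
  split=> [|h f fE x Ex]; first exact: killers_closed.
  by rewrite /= (act_kills _ stE fE Ex) linear0.
have [[f [fns fy]]|noy] :=
    pselect (exists f, (forall n, n \in ns -> X (actl f n)) /\ ~ X (actl f y)).
  have [||g _ [gns gn0]] := @orbit_full setT ns y n0 _ Ny _ Nn0.
  - by split=> //; split.
  - by exists f.
  have Nyj : N (y - actl j y) by apply: ssB => //; apply: coN.
  have [|k kE [kns ky]] := @orbit_full _ ns y (y - actl j y) mulE Ny _ Nyj.
    exists (j0 \o actl g) => [x Ex /=|]; first by apply: j0E; apply: stE.
    split=> [n nns|]; rewrite -act_act; first by apply: coX; apply: gns.
    move=> Xg; apply: j0n0; rewrite -[n0](subrK (actl g y)) linearD.
    by apply: ssD => //; apply: coX.
  exists (1 \*: k \+ j); first exact: (killers_closed E).2.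
  move=> n; rewrite inE act_comb scale1r => /orP[/eqP ->|nns].
    by rewrite -addrA addrC -[_ + _]opprK; apply: ssN; rewrite opprD opprB.
  by rewrite -addrA; apply: ssD; [apply: kns | apply: jns].
exists j => // n; rewrite inE => /orP[/eqP ->|/jns//].
apply: contrapT => jy; apply: noy; exists (counit \- j).
split=> [m mns|]; rewrite act_sub act_counit -opprB.
  by apply: ssN; apply: jns.
by move=> /ssN; rewrite opprK.
Qed.

(** The coefficients of the simple comodule [N / X] form a simple subcoalgebra [D]: if the
    annihilator of a subcoalgebra [E] of [D] acts as zero on [N / X], then [E] is all of [D];
    otherwise it contains an identity [j] on [N / X], so that the counit agrees with [j] on
    [D], vanishes on [E], and forces [E] to be zero. *)
Lemma simple_quotient_in_wedge S U : fin_dim N -> ~ (N `<=` X) -> stable U -> N `<=` U ->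
  (forall D, simple_subcoalg D -> D `<=` U -> D `<=` S) -> N `<=` wedge S X.
Proof.
move=> [ns Nns] nNX stU NU SU.
pose A := [set x | exists phi n, [/\ kills phi X, N n & x = actr phi n]].
have stA : stable (span A).
  move=> b h; apply: span_linear => _ [phi [n [phiX Nn ->]]]; apply: sub_span; case: b.
    by exists phi, (actl h n); rewrite (act_commute true); split=> //; apply: coN.
  exists (h \o actr phi), n; rewrite act_act; split=> // x Xx /=.
  by rewrite (act_swap true) phiX //; apply: coX.
pose D := stable_subcoalg stA.
have DU : D `<=` U by apply: span_min => _ [phi [n [_ /NU Un ->]]]; apply: stU.
have sD : simple_subcoalg D.
  split.
    move/existsNP: nNX => [n /not_implyP[Nn /separating_functional[phi [phiX phin]]]].
    exists (actr phi n); first by apply: sub_span; exists phi, n.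
    move=> phin0; move: phin; rewrite -(counit_act false) phin0 linear0 => /esym/eqP.
    by rewrite oner_eq0.
  move=> E ED; have stE := @subcoalg_stable _ _ E.
  have [EX|] := pselect (forall j n, kills j E -> N n -> X (actl j n)).
    right; apply/seteqP; split=> //; apply: span_min => _ [phi [n [phiX Nn ->]]].
    apply: contrapT => /separating_functional[j [jE]].
    by rewrite (act_swap true) phiX; [move/esym/eqP; rewrite oner_eq0 | apply: EX].
  move=> /existsNP[j0 /existsNP[n0 /not_implyP[j0E /not_implyP[Nn0 j0n0]]]]; left.
  have [|j jE jns] := local_identity (ns := ns) j0E Nn0 j0n0.
    by rewrite Nns; apply: sub_span.
  have jN n : N n -> X (actl (counit \- j) n).
    rewrite Nns; apply: span_linear => m mns; rewrite act_sub act_counit -opprB.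
    by apply: ssN; apply: jns.
  have jD x : D x -> (counit \- j) x = 0.
    apply: (@span_eq_ext _ _ _ (counit \- j) \0) => _ [phi [n [phiX Nn ->]]].
    by rewrite (act_swap true) phiX //; apply: jN.
  have counitE : kills counit E.
    by move=> x Ex; have := jD x (ED x Ex); rewrite /= jE // subr0.
  apply/seteqP; split=> [x Ex|_ ->]; last exact: ss_zero.
  by rewrite /= -[x](act_counit true) (act_kills _ stE counitE Ex).
move=> n Nn; apply/wedgePl => f fS; apply: contrapT.
move=> /separating_functional[phi [phiX]]; rewrite -(act_swap true) fS.
  by move/esym/eqP; rewrite oner_eq0.
by apply: (SU D sD DU); apply: sub_span; exists phi, n.
Qed.

End SimpleQuotient.

(** The induction runs on the length of the comodule [N / X]. For a subcoalgebra [N] and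
    [X = 0] this says that the radical of the dual algebra of [N] is nilpotent. *)
Lemma coideal_in_wedges S U X N : stable U ->
  (forall D, simple_subcoalg D -> D `<=` U -> D `<=` S) ->
  left_coideal X -> left_coideal N -> fin_dim N -> X `<=` N -> N `<=` U ->
  exists n, N `<=` wedges S X n.
Proof.
move=> stU SU; have [m] := ubnP (rk N - rk X); elim: m X N => // m IH X N.
rewrite ltnS => NXm coX coN fdN XN NU.
have [NX|NX] := pselect (N `<=` X); first by exists 0%N.
have [[Y [coY XY YN YX NY]]|simpleN] := pselect (exists Y, [/\ left_coideal Y, X `<=` Y,
    Y `<=` N, ~ (Y `<=` X) & ~ (N `<=` Y)]); last first.
  exists 1%N; apply: (simple_quotient_in_wedge coX coN XN _ fdN NX stU NU SU) => Y coY XY YN.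
  have [YX|YX] := pselect (Y `<=` X); first by left.
  by right; apply: contrapT => NY; apply: simpleN; exists Y.
have fdY := fin_dim_sub YN fdN.
have rkXY := rk_lt fdY XY YX; have rkYN := rk_lt fdN YN NY.
have [||p Yp] := IH X Y _ coX coY fdY XY.
- by apply: leq_trans NXm; apply: ltn_sub2r => //; apply: ltn_trans rkYN.
- exact: subset_trans YN NU.
have [|q Nq] := IH Y N _ coY coN fdN YN NU.
  by apply: leq_trans NXm; apply: ltn_sub2l => //; apply: ltn_trans rkYN.
by exists (q + p)%N; rewrite wedgesD; apply: subset_trans Nq _; apply: wedges_mono.
Qed.

(** * From semisimple to arbitrary finite-dimensional subspaces *)

(** Any two finite-dimensional subspaces lie in a finite-dimensional subcoalgebra [U], this in
    a power of the sum [S] of its simple subcoalgebras, and their wedge in twice that power. *)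
Lemma locally_finite_of_semisimple :
  (forall U, finite_sum (@simple_subcoalg _ C) U -> fin_dim (wedge U U)) ->
  locally_finite C.
Proof.
move=> fdw V W fdV fdW.
have [U [stU fdU VWU]] := fin_dim_in_stable (fin_dim_add fdV fdW).
pose Q := [set D : subcoalg C | simple_subcoalg D /\ D `<=` U].
have QU : span (\bigcup_(D in Q) (D : set C)) `<=` U.
  by apply: span_min => x [D [_ DU]]; apply: DU.
have [S QS sS] := fin_dim_finite_sum (fin_dim_sub QU fdU) (@subset_refl _ _).
have simpleS : finite_sum (@simple_subcoalg _ C) S.
  by elim: QS => [|D X [sD _] _ sX]; [constructor | apply: finite_sum_cons].
have [||||||n Un] := @coideal_in_wedges S U (zerosp C) U stU.
- by move=> D sD DU x Dx; apply: sS; apply: sub_span; exists D.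
- by move=> f _ ->; rewrite /= linear0.
- by move=> f c; apply: stU.
- by [].
- by move=> _ ->; apply: ss_zero.
- by [].
have fdS := finite_sum_fin_dim simpleS.
apply: fin_dim_sub (fin_dim_wedges (n + n) fdS (fdw S simpleS)) => c /wedgePl cVW.
have VWn := subset_trans VWU Un.
apply: wedges_wedge => f fn; apply: (VWn); apply: addsp_subr.
by apply: cVW => x Vx; apply: fn; apply: VWn; apply: addsp_subl.
Qed.

End WedgePowers.

(** * The Gabriel quiver *)

Lemma finite_sig T (B : set T) : finite_set B -> finite_set [set: {x | B x}].
Proof.
move=> finB; have [[y]|noB] := pselect (inhabited {x | B x}); last first.
  by rewrite (_ : [set: _] = set0) //; apply/seteqP; split=> // x _; apply: noB.
pose g x := if pselect (B x) is left Bx then exist B x Bx else y.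
apply: sub_finite_set (finite_image g finB) => -[x Bx] _; exists x => //.
by rewrite /g; case: pselect => // Bx'; congr exist; apply: Prop_irrelevance.
Qed.

Section Quiver.
Variables (K : fieldType) (C : coalgType K).
Implicit Types (D E : subcoalg C) (c : C).
Local Notation C0 := (coradical C).
Local Notation P := (quotsp C0).
Local Notation pi := (quot_proj C0).

Lemma rho_l_slice (f : dual C) c : lslice P f (rho_l C (pi c)) = pi (actl f c).
Proof.
rewrite [rho_l C _]quot_liftE /= lslice_map actlE; congr (pi _).
exact: lslice_eq.
Qed.

Lemma rho_r_slice (g : dual C) c : rslice P g (rho_r C (pi c)) = pi (actr g c).
Proof.
rewrite [rho_r C _]quot_liftE /= rslice_map actrE; congr (pi _).
exact: rslice_eq.
Qed.

Lemma lact_pi E (f : dual (subcoalg_type E)) c :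
  lact f (pi c) = pi (actr (f \o retr E) c).
Proof. by rewrite -rho_r_slice rslice_tens_map. Qed.

Lemma ract_pi D (g : dual (subcoalg_type D)) c :
  ract g (pi c) = pi (actl (g \o retr D) c).
Proof. by rewrite -rho_l_slice lslice_tens_map. Qed.

Lemma bipart_pi D E c : simple_subcoalg D -> simple_subcoalg E ->
  bipart D E (pi c) <-> block D E c.
Proof.
move=> sD sE; split=> [[_ /tens_subP[hl _] /tens_subP[_ hr]]|/blockP[hl hr]].
  apply/blockP; split=> f fk; apply/quot_proj_eq0.
    by rewrite -rho_l_slice hl.
  by rewrite -rho_r_slice hr.
have C1c : coradical_filtration C 1 c.
  by apply/wedgePl => f fk; apply: hl => x Dx; apply: fk; apply: simple_sub_coradical Dx.
have stC1 : stable (coradical_filtration C 1).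
  by apply: stable_wedge; apply: subcoalg_stable.
split; first by exists c.
  apply/tens_subP; split.
    by move=> f fD; rewrite rho_l_slice; apply/quot_proj_eq0; apply: hl.
  apply/rslice_kills => f; rewrite rho_l_slice; exists (actl f c) => //.
  exact: stC1.
apply/tens_subP; split; last first.
  by move=> g gE; rewrite rho_r_slice; apply/quot_proj_eq0; apply: hr.
apply/lslice_kills => g; rewrite rho_r_slice; exists (actr g c) => //.
exact: stC1.
Qed.

(** A class [c] modulo [C_0] is not changed by the functionals that project [C_0] onto [D] on
    the left and onto [E] on the right; applied to [c] in [C_1], they give an element of
    [D /\ E]. *)
Lemma bipart_in_wedge D E : simple_subcoalg D -> simple_subcoalg E ->
  bipart D E `<=` imsp pi (wedge D E).
Proof.
move=> sD sE; elim/quot_projP => c /(bipart_pi _ sD sE)/blockP[cl cr].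
have [hD [hDD projD]] := counit_of_simple sD; have [hE [hEE projE]] := counit_of_simple sE.
exists (actl hD (actr hE c)).
  apply/wedgePl => f fD; rewrite act_act (act_commute true); apply: projE.
  apply: cl => x Dx /=; apply: fD; apply: projD; exact: simple_sub_coradical Dx.
apply/esym/quot_proj_eq; rewrite -[c in c - _](subrK (actl hD c)) -addrA.
apply: ssD.
  rewrite -[X in X - _](act_counit true) -act_sub; apply: cl => x Dx /=.
  by rewrite hDD ?subrr.
rewrite -linearB; apply: subcoalg_stable.
rewrite -[X in X - _](act_counit false) -act_sub; apply: cr => x Ex /=.
by rewrite hEE ?subrr.
Qed.

Variable e : idempotent_choice C.

Lemma finite_arrows_of_fin_dim (i j : simple_index C) :
  fin_dim (arrow_space e i j) ->
  finite_set [set: arrow (q := gabriel_quiver e) i j].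
Proof.
have [free spanB] := basisP (arrow_space e i j).
move=> [s As]; have Bs : basis (arrow_space e i j) `<=` span [set` s].
  by rewrite -As -[X in _ `<=` X]spanB; apply: sub_span.
exact: finite_sig (free_finite free Bs).
Qed.

Lemma fin_dim_of_finite_arrows (i j : simple_index C) :
  finite_set [set: arrow (q := gabriel_quiver e) i j] ->
  fin_dim (arrow_space e i j).
Proof.
move=> /(finite_image sval)/finite_seqP[s Bs]; exists s; rewrite -Bs.
apply: subspace_ext; have [_ <-] := basisP (arrow_space e i j).
congr (span _ : set _); apply/seteqP; split=> [x Bx|_ [[x Bx] _ <-] //].
by exists (exist _ x Bx).
Qed.

(** A primitive idempotent is nonzero, hence generates the simple dual algebra as an ideal;
    this is used first on the left, then on the right. *)
Lemma finite_mod_block_of_arrows (i j : simple_index C) :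
  fin_dim (arrow_space e i j) -> finite_mod (block (simple_at j) (simple_at i)).
Proof.
set D := simple_at j; set E := simple_at i => fdA.
have sD : simple_subcoalg D := svalP j; have sE : simple_subcoalg E := svalP i.
pose h (k : simple_index C) : dual C := sval e k \o retr (simple_at k).
have hk k : ~ kills (h k) (simple_at k).
  have [_ ek0 _] := svalP e k; move=> hk; apply: ek0 => x.
  by rewrite -[x in LHS](retrK x); apply: hk; apply: inclP.
have stB : stable (block D E) by apply: block_stable; apply: subcoalg_stable.
apply: (finite_mod_of_act_simple sD (hk j) (b := true)).
- by move=> f c; apply: stB.
- by move=> f c fD /blockP[cl _]; apply: cl.
apply: (finite_mod_of_act_simple sE (hk i) (b := false)).
- move=> f _ [c Bc <-]; exists (actr f c); first exact: stB.
  by rewrite (act_commute true).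
- move=> f _ fE [c /blockP[_ cr] <-]; rewrite -(act_commute true).
  by apply: subcoalg_stable; apply: cr.
apply: fin_dim_sub fdA => _ [_ [_ [c Bc <-] <-] <-].
exists (pi c); first exact/bipart_pi.
by rewrite -[LHS]/(lact (sval e i) (ract (sval e j) (pi c))) ract_pi lact_pi.
Qed.

End Quiver.

Theorem theorem5p2 (K : fieldType) (C : coalgType K) (e : idempotent_choice C) :
  (locally_finite C -> quiver_locally_finite (gabriel_quiver e)) /\
  (quiver_locally_finite (gabriel_quiver e) ->
     separable (subcoalg_type (coradical C)) -> locally_finite C).
Proof.
split=> [Cfin i j|Qfin _].
  have sD := svalP j; have sE := svalP i.
  apply: finite_arrows_of_fin_dim; apply: fin_dim_im.
  apply: fin_dim_sub (bipart_in_wedge sD sE) _; apply: fin_dim_im.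
  by apply: Cfin; apply: simple_fin_dim.
apply: locally_finite_of_semisimple => U sU; apply: fin_dim_wedge_semisimple sU.
move=> D E sD sE.
exact: (finite_mod_block_of_arrows (i := exist _ E sE) (j := exist _ D sD)
          (fin_dim_of_finite_arrows (Qfin _ _))).
Qed.
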